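(* Let $X$ be a reflexive Banach space with a symmetric basis $(e_n)_{n=1}^\infty$ whose lower Boyd index satisfies $p_X>1$. Then $X$ admits an equivalent $2R$ norm for which $(e_n)_{n=1}^\infty$ is $1$-symmetric.
   Context: For $K\ge1$, a basis $(e_n)$ is $K$-symmetric if $\|\sum_n \pm a_{\sigma(n)} e_n\|\le K\|\sum_n a_n e_n\|$ for all scalars $(a_n)$, all choices of signs and all permutations $\sigma$ of $\mathbb{N}$; it is symmetric if it is $K$-symmetric for some $K$. A norm $\|\cdot\|$ on a Banach space $X$ is $2$-rotund ($2R$) if for every sequence $(x_n)\subset X$ with $\|x_n\|\le 1$ for all $n$ and $\lim_{m,n\to\infty}\|x_m+x_n\|=2$ there is $x\in X$ with $x_n\to x$ in norm. Lower Boyd index: for $m\in\mathbb{N}$ let $D_m\colon X\to X$ be the bounded linear operator $D_m(\sum_{n} a_n e_n)=\sum_{n} a_n\bigl(\sum_{j=(n-1)m+1}^{nm}e_j\bigr)$. Then $$p_X=\sup_{m\ge2}\frac{\log m}{\log\|D_m\|}=\lim_{m\to\infty}\frac{\log m}{\log\|D_m\|}.$$ *)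

(* Defs.v *)
From HB Require Import structures.
From mathcomp Require Import all_boot all_order all_algebra.
From mathcomp Require Import all_classical all_reals all_analysis.

Set Implicit Arguments.
Unset Strict Implicit.
Unset Printing Implicit Defensive.

Import Order.TTheory GRing.Theory Num.Theory.
Import numFieldNormedType.Exports.

Local Open Scope classical_set_scope.
Local Open Scope ring_scope.

Record norm_on (R : realType) (X : lmodType R) := NormOn {
  norm_fun :> X -> R;
  norm_onD : forall x y, norm_fun (x + y) <= norm_fun x + norm_fun y;
  norm_onZ : forall (a : R) x, norm_fun (a *: x) = `|a| * norm_fun x;
  norm_on0_eq0 : forall x, norm_fun x = 0 -> x = 0
}.

(* The vector space X with the norm N and the topology it induces, whatever
   norm X may already carry. *)
Definition renormed (R : realType) (X : lmodType R) (N : norm_on X) : Type := X.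

HB.instance Definition _ (R : realType) (X : lmodType R) (N : norm_on X) :=
  GRing.Lmodule.on (renormed N).

HB.instance Definition _ (R : realType) (X : lmodType R) (N : norm_on X) :=
  @Lmodule_isNormed.Build R (renormed N) N
    (@norm_onD R X N) (@norm_onZ R X N) (@norm_on0_eq0 R X N).

Lemma renormedE (R : realType) (X : lmodType R) (N : norm_on X)
  (x : renormed N) : `|x| = N x.
Proof. by []. Qed.

Definition equivalent_norm (R : realType) (X : normedModType R)
    (N : norm_on X) : Prop :=
  exists c C : R,
    [/\ 0 < c, 0 < C & forall x : X, c * `|x| <= N x <= C * `|x|].

(* Valued in \bar R: +oo when T is unbounded. *)
Definition opnorm (R : realType) (V W : normedModType R) (T : V -> W) : \bar R :=
  ereal_sup [set `|T x|%:E | x in [set x : V | `|x| <= 1]].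

Definition dual_space (R : realType) (X : normedModType R) : set (X -> R^o) :=
  [set f | linear f /\ continuous f].

(* Elements of X**, as functions of which only the values on [dual_space X] matter. *)
Definition bidual (R : realType) (X : normedModType R)
    : set ((X -> R^o) -> R) :=
  [set phi |
    (forall (a : R) (f g : X -> R^o), dual_space f -> dual_space g ->
       phi (fun x => a * f x + g x) = a * phi f + phi g) /\
    (exists M : R, forall f : X -> R^o, dual_space f ->
       (`|phi f|%:E <= M%:E * opnorm f)%E)].

Definition reflexive_space (R : realType) (X : normedModType R) : Prop :=
  forall phi, @bidual R X phi ->
    exists x : X, forall f : X -> R^o, dual_space f -> phi f = f x.

Definition is_basis (R : realType) (X : normedModType R) (e : nat -> X) : Prop :=
  forall x : X, exists! a : nat -> R, series (fun n => a n *: e n) @ \oo --> x.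

Definition K_symmetric (R : realType) (X : normedModType R) (K : R)
    (e : nat -> X) : Prop :=
  [/\ 1 <= K, is_basis e &
    forall (a : nat -> R) (s : nat -> bool) (sigma : nat -> nat) (x : X),
      bijective sigma -> series (fun n => a n *: e n) @ \oo --> x ->
      exists2 y : X,
        series (fun n => ((-1) ^+ s n * a (sigma n)) *: e n) @ \oo --> y &
        `|y| <= K * `|x|].

Definition symmetric_basis (R : realType) (X : normedModType R)
    (e : nat -> X) : Prop :=
  exists K : R, K_symmetric K e.

Definition two_rotund (R : realType) (X : normedModType R) : Prop :=
  forall u : nat -> X, (forall n, `|u n| <= 1) ->
    `|u p.1 + u p.2| @[p --> (\oo, \oo)] --> (2 : R) ->
    exists x : X, u @ \oo --> x.

Definition coords (R : realType) (X : normedModType R) (e : nat -> X) (x : X)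
    : nat -> R :=
  xget (fun=> 0) [set a : nat -> R | series (fun n => a n *: e n) @ \oo --> x].

(* The operator D_m; the basis is indexed from 0, so the block replacing
   e_n is e_(nm), ..., e_(nm+m-1). *)
Definition dilation (R : realType) (X : normedModType R) (e : nat -> X)
    (m : nat) (x : X) : X :=
  limn (series (fun n =>
    coords e x n *: \sum_(n * m <= j < n.+1 * m) e j)).

(* In \bar R, a / 0 = +oo for a > 0, hence p_X = +oo if some m >= 2 has
   ||D_m|| = 1. *)
Definition lower_boyd (R : realType) (X : normedModType R) (e : nat -> X)
    : \bar R :=
  ereal_sup [set ((ln (m%:R : R))%:E / lne (opnorm (dilation e m)))%E
            | m in [set m : nat | (2 <= m)%N]].

(* Main.v *)
Require Import Defs.
From HB Require Import structures.
From mathcomp Require Import all_boot all_order all_algebra.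
From mathcomp Require Import all_classical all_reals all_analysis.
From mathcomp Require Import finmap ring lra.

Set Implicit Arguments.
Unset Strict Implicit.
Unset Printing Implicit Defensive.

Import Order.TTheory GRing.Theory Num.Theory.
Import numFieldNormedType.Exports.

Local Open Scope classical_set_scope.
Local Open Scope ring_scope.

(* Let h_j(x) be the sum of the j largest moduli of coordinates of x.  Since
   p_X > 1, some m satisfies ||D_m|| < m, and this makes the Hardy-type map
   x |-> V x, where V x has the coordinate h_{m^k}(x) / m^k on [m^k, m^(k+1)),
   bounded on X.  The map V is even, coordinatewise subadditive and invariant
   under permutations, so composing it with any monotone norm, symmetric or not,
   gives a symmetric norm on X, which is moreover equivalent to the original one.

   The new norm is the l2-sum of countably many multiples of such seminorms: the
   h_j, their Euclidean analogues, and q_k (V x + q_0 (V x) c), where q_k is a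
   monotone seminorm of the k-th tail and c ranges over a countable dense subset
   of the positive cone.  If N(u_n) <= 1 and N(u_m + u_n) -> 2, then every one of
   them behaves along (u_n) as along a constant sequence.  By the argument of
   Odell and Schlumprecht, a subsequence of (V u_n) then has all its convex
   combinations almost as large for q_k as its terms; by the Hahn-Banach theorem
   and reflexivity its weak limit is that large too.  The coordinates of this
   limit do not depend on k, so the tails of V u_n are uniformly small.  The
   Euclidean seminorms show that (u_n) is Cauchy for the sup norm, by comparing
   the sets of largest coordinates at a gap, and both facts together show that
   (u_n) is Cauchy in X. *)

(** * A Hahn-Banach theorem *)

(** The translates [x |-> q (x + q x c)] that force a 2R norm on a reflexive space are not invariant
    under permutations. Taking them after V makes each of them symmetric while their number stays
    countable. The price is that V is neither linear nor injective: it forgets signs and identifies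
    all rearrangements of a vector, so control of V u_n alone cannot show that (u_n) converges. The
    Euclidean seminorms supply the missing positions of the large coordinates. Since V is only
    subadditive, inequalities are made between vectors with nonnegative coordinates and then passed
    through a monotone norm; this is why c stays in the positive cone.

    On a decreasing sequence V is dominated by a multiple of the sum over l of [D_m^(l+2) / m^l],
    which converges because ||D_m|| < m. The l2-sum serves because each of its terms has a
    nonnegative parallelogram defect: a small defect of the whole norm makes every single defect
    small. *)

Section hahn_banach.
Context (R : realType) (V : lmodType R).
Implicit Types (p r : V -> R) (x y : V) (t : R).

Definition sublinear p :=
  (forall x y, p (x + y) <= p x + p y) /\
  (forall t x, 0 <= t -> p (t *: x) <= t * p x).

Lemma sublinear0 p : sublinear p -> p 0 = 0.
Proof.
move=> [pD pZ]; have := pZ 0 0 (lexx _); have := pD 0 0.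
rewrite scaler0 addr0 mul0r => h1 h2; lra.
Qed.

Lemma sublinearZ p t x : sublinear p -> 0 <= t -> p (t *: x) = t * p x.
Proof.
move=> sp; have [pD pZ] := sp; rewrite le_eqVlt => /orP[/eqP<-|t0].
  by rewrite scale0r mul0r sublinear0.
apply/eqP; rewrite eq_le (pZ _ _ (ltW t0))/=.
have := pZ t^-1 (t *: x); rewrite scalerA mulVf ?gt_eqF// scale1r => /(_ _)H.
by rewrite -ler_pdivlMl//; apply: H; rewrite invr_ge0 ltW.
Qed.

Lemma sublinear_ge_opp p x : sublinear p -> - p (- x) <= p x.
Proof.
by move=> sp; have := sp.1 x (- x); rewrite subrr sublinear0//; lra.
Qed.

Let dominated p := {r : V -> R | sublinear r /\ forall x, r x <= p x}.

(** Zorn's lemma for the reversed pointwise order. A chain is bounded by its pointwise infimum,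
    which is finite because every member is at least [- p (- x)] at [x], and subadditive because any
    two members are comparable. *)
Lemma minimal_sublinear p : sublinear p ->
  exists r, [/\ sublinear r, forall x, r x <= p x &
    forall s, sublinear s -> (forall x, s x <= r x) -> s = r].
Proof.
move=> sp.
pose rel (s t : dominated p) := `[< forall x, sval t x <= sval s x >].
have [|||A totA|[r [sr rp]] rmin] := @Zorn (dominated p) rel.
- by move=> s; apply/asboolP.
- by move=> s t u /asboolP st /asboolP tu; apply/asboolP => x; exact: le_trans (st x).
- move=> [s ?] [t ?] /asboolP/= st /asboolP/= ts; apply: eq_exist.
  by apply/funext => x; apply/eqP; rewrite eq_le st ts.
- have [->|/set0P[s0 As0]] := eqVneq A set0.
    by exists (exist (fun r => sublinear r /\ forall x, r x <= p x) p (conj sp (fun=> lexx _))).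
  pose vals x := [set sval s x | s in A].
  have vals0 x : vals x !=set0 by exists (sval s0 x); exists s0.
  have lbv x : lbound (vals x) (- p (- x)).
    move=> _ [[s [ss sps]] _ <-] /=; have := sublinear_ge_opp x ss.
    by have := sps (- x); lra.
  have infle s x : A s -> inf (vals x) <= sval s x.
    by move=> As; apply: ge_inf; [exists (- p (- x))|exists s].
  have infP : sublinear (fun x => inf (vals x)).
    split=> [x y|t x t0].
      rewrite -lerBlDr; apply: lb_le_inf => // _ [s As <-].
      rewrite lerBlDl -lerBlDr; apply: lb_le_inf => // _ [u Au <-].
      rewrite lerBlDl; case: (totA s u As Au) => /asboolP us.
        apply: (le_trans (infle u _ Au)); have := (svalP u).1.1 x y.
        by have := us x; lra.
      apply: (le_trans (infle s _ As)); have := (svalP s).1.1 x y.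
      by have := us y; lra.
    move: t0; rewrite le_eqVlt => /orP[/eqP<-|t0].
      rewrite scale0r mul0r; have := infle _ 0 As0.
      by rewrite (sublinear0 (svalP s0).1).
    rewrite -ler_pdivrMl//; apply: lb_le_inf => // _ [s As <-].
    rewrite ler_pdivrMl//; apply: (le_trans (infle s _ As)).
    by apply: (svalP s).1.2; exact: ltW.
  have infp x : inf (vals x) <= p x.
    by apply: (le_trans (infle _ _ As0)); exact: (svalP s0).2.
  exists (exist (fun r => sublinear r /\ forall x, r x <= p x) _ (conj infP infp)).
  by move=> s As; apply/asboolP => x /=; exact: infle.
- exists r; split => // s ss sr'.
  have sp' x : s x <= p x by exact: le_trans (rp x).
  have /(_ _)/(congr1 sval) := rmin (exist _ s (conj ss sp')).
  by apply; apply/asboolP => x /=.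
Qed.

(** For fixed [y], the infimum over [t >= 0] of [r (x + t *: y) - t * r y] is sublinear and below
    [r], so minimality makes it equal to [r]; comparison with the term [t = 1] gives the missing
    inequality [r x + r y <= r (x + y)]. *)
Lemma minimal_sublinear_linear r : sublinear r ->
  (forall s, sublinear s -> (forall x, s x <= r x) -> s = r) ->
  linear (r : V -> R^o).
Proof.
move=> sr rmin; have [rD rZ] := sr.
have radd x y : r (x + y) = r x + r y.
  apply/eqP; rewrite eq_le rD/=.
  pose vals z := [set r (z + t *: y) - t * r y | t in [set t | 0 <= t]].
  have vals0 z : vals z !=set0 by exists (r (z + 0 *: y) - 0 * r y), 0 => /=.
  have lbv z : lbound (vals z) (- r (- z)).
    move=> _ [t /= t0 <-]; rewrite -(sublinearZ y sr t0).
    by have := rD (z + t *: y) (- z); rewrite addrAC subrr add0r; lra.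
  have infle t z : 0 <= t -> inf (vals z) <= r (z + t *: y) - t * r y.
    by move=> t0; apply: ge_inf; [exists (- r (- z))|exists t].
  have infr z : inf (vals z) <= r z.
    by apply: (le_trans (infle 0 z (lexx _))); rewrite scale0r mul0r addr0 subr0.
  have infP : sublinear (fun z => inf (vals z)).
    split=> [u v|t u t0].
      rewrite -lerBlDr; apply: lb_le_inf => // _ [s /= s0 <-].
      rewrite lerBlDl -lerBlDr; apply: lb_le_inf => // _ [t /= t0 <-].
      rewrite lerBlDl; apply: (le_trans (infle (s + t) _ (addr_ge0 s0 t0))).
      have := rD (u + s *: y) (v + t *: y).
      by rewrite addrACA -scalerDl; lra.
    move: t0; rewrite le_eqVlt => /orP[/eqP<-|t0].
      by rewrite scale0r mul0r; have := infr 0; rewrite (sublinear0 sr).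
    rewrite -ler_pdivrMl//; apply: lb_le_inf => // _ [s /= s0 <-].
    rewrite ler_pdivrMl//; apply: (le_trans (infle (t * s) _ _)).
      by rewrite mulr_ge0// ltW.
    by rewrite -scalerA -scalerDr (sublinearZ _ sr (ltW t0)) mulrBr mulrA.
  rewrite -{1}(rmin _ infP infr); have := infle 1 x ler01.
  by rewrite scale1r mul1r; lra.
have rN x : r (- x) = - r x.
  by have := radd x (- x); rewrite subrr (sublinear0 sr); lra.
move=> a u v /=; rewrite radd; congr (_ + _).
have [a0|a0] := leP 0 a; first by rewrite (sublinearZ u sr a0).
rewrite -[a in LHS]opprK scaleNr rN (sublinearZ u sr) ?oppr_ge0 1?ltW//.
by rewrite mulNr opprK.
Qed.

Lemma hahn_banach_sublinear p : sublinear p ->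
  exists f : V -> R^o, linear f /\ forall x, f x <= p x.
Proof.
move=> /minimal_sublinear[r [sr rp rmin]]; exists r; split => //.
exact: minimal_sublinear_linear.
Qed.

(* The functional is obtained from [x |-> inf (p (x + g.1) - g.2)], the infimum
   being over the cone [G]. *)
Lemma hahn_banach_cone p (G : set (V * R)) : sublinear p -> G (0, 0) ->
  (forall g h, G g -> G h -> G (g.1 + h.1, g.2 + h.2)) ->
  (forall t g, 0 <= t -> G g -> G (t *: g.1, t * g.2)) ->
  (forall g, G g -> g.2 <= p g.1) ->
  exists f : V -> R^o, [/\ linear f, forall x, f x <= p x &
    forall g, G g -> g.2 <= f g.1].
Proof.
move=> sp G0 GD GZ Gp; have [pD pZ] := sp.
pose vals x := [set p (x + g.1) - g.2 | g in G].
have vals0 x : vals x !=set0 by exists (p (x + 0) - 0), (0, 0).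
have lbv x : lbound (vals x) (- p (- x)).
  move=> _ [g /Gp gp <-]; have := pD (x + g.1) (- x).
  by rewrite addrAC subrr add0r; lra.
have infle g x : G g -> inf (vals x) <= p (x + g.1) - g.2.
  by move=> Gg; apply: ge_inf; [exists (- p (- x))|exists g].
have infp x : inf (vals x) <= p x.
  by have := infle _ x G0; rewrite addr0 subr0.
have infP : sublinear (fun x => inf (vals x)).
  split=> [u v|t u t0].
    rewrite -lerBlDr; apply: lb_le_inf => // _ [g Gg <-].
    rewrite lerBlDl -lerBlDr; apply: lb_le_inf => // _ [h Gh <-].
    rewrite lerBlDl; apply: (le_trans (infle _ _ (GD _ _ Gg Gh))) => /=.
    by have := pD (u + g.1) (v + h.1); rewrite addrACA; lra.
  move: t0; rewrite le_eqVlt => /orP[/eqP<-|t0].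
    by rewrite scale0r mul0r; have := infp 0; rewrite (sublinear0 sp).
  rewrite -ler_pdivrMl//; apply: lb_le_inf => // _ [g Gg <-].
  rewrite ler_pdivrMl//; apply: (le_trans (infle _ _ (GZ _ _ (ltW t0) Gg))) => /=.
  by rewrite -scalerDr (sublinearZ _ sp (ltW t0)) mulrBr.
have [f [lf fS]] := hahn_banach_sublinear infP.
exists f; split => // [x|g Gg]; first exact: le_trans (fS x) (infp x).
have fN : f (- g.1) = - f g.1.
  have := lf (-1) g.1 0; have := lf (-1) 0 0.
  by rewrite !scaleN1r !addr0 oppr0 addNr => -> ->; rewrite addr0.
have := fS (- g.1); rewrite fN; have := infle _ (- g.1) Gg.
by rewrite addNr (sublinear0 sp); lra.
Qed.

End hahn_banach.

(** * Seminorms and their l2-sums *)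

Section seminorm.
Context (R : realType) (V : lmodType R).
Implicit Types (p : V -> R) (x y : V).

Definition seminorm p :=
  (forall x y, p (x + y) <= p x + p y) /\
  (forall a x, p (a *: x) = `|a| * p x).

Lemma seminorm0 p : seminorm p -> p 0 = 0.
Proof. by case=> _ pZ; rewrite -(scale0r 0) pZ normr0 mul0r. Qed.

Lemma seminormN p x : seminorm p -> p (- x) = p x.
Proof. by case=> _ pZ; rewrite -scaleN1r pZ normrN1 mul1r. Qed.

Lemma seminorm_ge0 p x : seminorm p -> 0 <= p x.
Proof.
move=> sp; have := sp.1 x (- x); rewrite subrr seminorm0// seminormN//; lra.
Qed.

Lemma seminorm_distr p x y : seminorm p -> p x - p y <= p (x - y).
Proof. by move=> sp; have := sp.1 (x - y) y; rewrite subrK; lra. Qed.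

Lemma seminorm_sublinear p : seminorm p -> sublinear p.
Proof. by move=> [pD pZ]; split=> // t x t0; rewrite pZ ger0_norm. Qed.

(** For norms given by suprema the scaling inequality is direct; applied to [a^-1] it yields the
    reverse one. *)
Lemma seminorm_of_le p : (forall x, 0 <= p x) ->
  (forall x y, p (x + y) <= p x + p y) ->
  (forall a x, p (a *: x) <= `|a| * p x) -> seminorm p.
Proof.
move=> p0 pD pZ; split=> // a x; apply/eqP; rewrite eq_le pZ/=.
have [->|a0] := eqVneq a 0; first by rewrite normr0 mul0r.
rewrite -ler_pdivlMl ?normr_gt0// -normfV; apply: le_trans (pZ _ _).
by rewrite scalerA mulVf// scale1r.
Qed.

End seminorm.

Lemma sqr_le_le (R : realType) (x y : R) : 0 <= y -> x ^+ 2 <= y ^+ 2 -> x <= y.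
Proof. by move=> y0 h; case: leP => // yx; nra. Qed.

Lemma l2_triangle (R : realType) (I : Type) (s : seq I) (a b : I -> R) :
  Num.sqrt (\sum_(i <- s) (a i + b i) ^+ 2) <=
  Num.sqrt (\sum_(i <- s) a i ^+ 2) + Num.sqrt (\sum_(i <- s) b i ^+ 2).
Proof.
elim: s => [|i s ih]; first by rewrite !big_nil sqrtr0 addr0.
rewrite !big_cons.
set S := \sum_(j <- s) (a j + b j) ^+ 2 in ih *.
set A := \sum_(j <- s) a j ^+ 2 in ih *.
set B := \sum_(j <- s) b j ^+ 2 in ih *.
have S0 : 0 <= S by apply: sumr_ge0 => *; exact: sqr_ge0.
have A0 : 0 <= A by apply: sumr_ge0 => *; exact: sqr_ge0.
have B0 : 0 <= B by apply: sumr_ge0 => *; exact: sqr_ge0.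
apply: sqr_le_le; first by rewrite addr_ge0// sqrtr_ge0.
have Ea := sqr_sqrtr (addr_ge0 (sqr_ge0 (a i)) A0).
have Eb := sqr_sqrtr (addr_ge0 (sqr_ge0 (b i)) B0).
rewrite [leRHS]sqrrD Ea Eb sqr_sqrtr ?addr_ge0 ?sqr_ge0//.
have ESA := sqr_sqrtr A0; have ESB := sqr_sqrtr B0; have ES := sqr_sqrtr S0.
have sA := sqrtr_ge0 A; have sB := sqrtr_ge0 B; have sS := sqrtr_ge0 S.
have su := sqrtr_ge0 (a i ^+ 2 + A); have sv := sqrtr_ge0 (b i ^+ 2 + B).
move: (Num.sqrt A) (Num.sqrt B) (Num.sqrt S) (Num.sqrt (a i ^+ 2 + A))
  (Num.sqrt (b i ^+ 2 + B)) => u v w x y in Ea Eb ESA ESB ES sA sB sS su sv ih *.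
(* Cauchy-Schwarz in the plane for the vectors [(a i, u)] and [(b i, v)]. *)
have cs : a i * b i + u * v <= x * y.
  apply: sqr_le_le; first exact: mulr_ge0.
  rewrite [leRHS]exprMn Ea Eb -ESA -ESB; have := sqr_ge0 (a i * v - b i * u); nra.
have : w ^+ 2 <= (u + v) ^+ 2 by rewrite lerXn2r ?nnegrE ?addr_ge0.
rewrite -ESA -ESB -ES -mulr_natr; nra.
Qed.

Section l2_sum_of_seminorms.
Context (R : realType) (X : normedModType R) (T : countType).
Context (p : T -> X -> R).
Hypothesis p_seminorm : forall t, seminorm (p t).
Hypothesis p_bounded : forall t, exists C : R, forall x, p t x <= C * `|x|.

Let p_bound : {C : T -> R | forall t, 0 <= C t /\ forall x, p t x <= C t * `|x|}.
Proof.
have /choice[C hC] t : exists C : R, 0 <= C /\ forall x, p t x <= C * `|x|.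
  have [C hC] := p_bounded t; exists (Num.max C 0); split=> [|x].
    by rewrite le_max lexx orbT.
  by apply: (le_trans (hC x)); rewrite ler_wpM2r// le_max lexx.
by apply: cid; exists C.
Qed.

Let C := sval p_bound.

(** The weight brings the term coded by [j] down to at most [2^-1 ^+ j.+1] times the norm, whatever
    its bound [C t]; codes of no index contribute zero. *)
Let scaled (j : nat) (x : X) : R :=
  if choice.unpickle j is Some t then 2^-1 ^+ j.+1 / (1 + C t) * p t x else 0.

Let C_ge0 t : 0 <= C t. Proof. exact: (svalP p_bound t).1. Qed.

Let scaled_seminorm j : seminorm (scaled j).
Proof.
rewrite /scaled; case: choice.unpickle => [t|]; last first.
  by split=> [x y|a x]; rewrite ?addr0 ?mulr0.
have c0 : 0 <= 2^-1 ^+ j.+1 / (1 + C t).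
  by rewrite divr_ge0// ?exprn_ge0// addr_ge0.
split=> [x y|a x].
  by rewrite -mulrDr ler_wpM2l//; exact: (p_seminorm t).1.
by rewrite (p_seminorm t).2 mulrCA.
Qed.

Let scaled_le j x : scaled j x <= 2^-1 ^+ j.+1 * `|x|.
Proof.
rewrite /scaled; case: choice.unpickle => [t|]; last first.
  by rewrite mulr_ge0// exprn_ge0.
rewrite -mulrA ler_wpM2l ?exprn_ge0// ler_pdivrMl ?ltr_pwDl//.
apply: (le_trans ((svalP p_bound t).2 x)).
by rewrite ler_wpM2r//; rewrite -/C; lra.
Qed.

Let partial J x := Num.sqrt (\sum_(0 <= j < J) scaled j x ^+ 2).

Let sumsq_ge0 J x : 0 <= \sum_(0 <= j < J) scaled j x ^+ 2.
Proof. by apply: sumr_ge0 => *; exact: sqr_ge0. Qed.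

Let partial_seminorm J : seminorm (partial J).
Proof.
split=> [x y|a x]; rewrite /partial.
  apply: le_trans (l2_triangle _ _ _).
  apply: ler_wsqrtr; apply: ler_sum => j _.
  rewrite lerXn2r ?nnegrE ?addr_ge0 ?(seminorm_ge0 _ (scaled_seminorm _))//.
  exact: (scaled_seminorm j).1.
under eq_bigr => j _ do rewrite (scaled_seminorm j).2 exprMn.
by rewrite -mulr_sumr sqrtrM ?sqr_ge0// sqrtr_sqr ger0_norm.
Qed.

Let partial_le J x : partial J x <= `|x|.
Proof.
apply: sqr_le_le => //; rewrite sqr_sqrtr//.
have geo : \sum_(0 <= j < J) 2^-1 ^+ j.+1 = 1 - 2^-1 ^+ J :> R.
  elim: J => [|J ih]; first by rewrite big_geq// expr0 subrr.
  rewrite big_nat_recr//= ih exprS.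
  have := @divff R 2; rewrite pnatr_eq0 => /(_ isT); lra.
apply: (@le_trans _ _ (\sum_(0 <= j < J) 2^-1 ^+ j.+1 * `|x| ^+ 2)).
  apply: ler_sum => j _.
  have s0 := seminorm_ge0 x (scaled_seminorm j).
  have e0 : 0 <= 2^-1 ^+ j.+1 :> R by rewrite exprn_ge0.
  have e1 : 2^-1 ^+ j.+1 <= 1 :> R by rewrite exprn_ile1 ?invr_le1 ?unitfE//; lra.
  apply: (@le_trans _ _ ((2^-1 ^+ j.+1 * `|x|) ^+ 2)).
    by rewrite lerXn2r ?nnegrE// mulr_ge0.
  by rewrite exprMn ler_wpM2r ?sqr_ge0//; nra.
have : 0 <= 2^-1 ^+ J :> R by rewrite exprn_ge0.
rewrite -mulr_suml geo.
by have := sqr_ge0 `|x|; nra.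
Qed.

Definition l2_sum (x : X) : R := sup [set partial J x | J in setT].

Let partial_l2_sum J x : partial J x <= l2_sum x.
Proof.
apply: ub_le_sup; last by exists J.
by exists `|x| => _ [K _ <-].
Qed.

Let l2_sum_le_ub x M : (forall J, partial J x <= M) -> l2_sum x <= M.
Proof.
move=> h; apply: sup_le_ub; first by exists (partial 0 x), 0%N.
by move=> _ [J _ <-].
Qed.

Lemma l2_sum_le x : l2_sum x <= `|x|.
Proof. by apply: l2_sum_le_ub => J. Qed.

Lemma l2_sum_seminorm : seminorm l2_sum.
Proof.
apply: seminorm_of_le => [x|x y|a x].
- by apply: le_trans (partial_l2_sum 0 _); exact: sqrtr_ge0.
- apply: l2_sum_le_ub => J; apply: (le_trans ((partial_seminorm J).1 x y)).
  by apply: lerD.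
- by apply: l2_sum_le_ub => J; rewrite (partial_seminorm J).2 ler_wpM2l.
Qed.

Lemma l2_sum_eq x y : (forall t, p t x = p t y) -> l2_sum x = l2_sum y.
Proof.
move=> pxy; rewrite /l2_sum; congr sup; apply: eq_imagel => J _.
rewrite /partial; congr Num.sqrt; apply: eq_bigr => j _; rewrite /scaled.
by case: choice.unpickle => [t|//]; rewrite pxy.
Qed.

Lemma l2_sum_ge t : exists2 c : R, 0 < c & forall x, c * p t x <= l2_sum x.
Proof.
pose j := choice.pickle t; have c0 : 0 < 2^-1 ^+ j.+1 / (1 + C t).
  by rewrite divr_gt0 ?exprn_gt0 ?invr_gt0// ltr_pwDl.
exists (2^-1 ^+ j.+1 / (1 + C t)) => // x.
apply: le_trans (partial_l2_sum j.+1 x); apply: sqr_le_le; first exact: sqrtr_ge0.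
rewrite sqr_sqrtr// big_nat_recr//= -[leLHS]add0r lerD//.
by rewrite /scaled /j choice.pickleK.
Qed.

(** All terms of the l2-sum have a nonnegative parallelogram defect, so the defect of one of them,
    with its squared weight [c], is at most the defect of the sum. *)
Lemma l2_sum_parallelogram t : exists2 c : R, 0 < c & forall x y,
  c * (2 * p t x ^+ 2 + 2 * p t y ^+ 2 - p t (x + y) ^+ 2) <=
  2 * l2_sum x ^+ 2 + 2 * l2_sum y ^+ 2 - l2_sum (x + y) ^+ 2.
Proof.
pose j := choice.pickle t; pose c := (2^-1 ^+ j.+1 / (1 + C t)) ^+ 2.
have c0 : 0 < c.
  by rewrite exprn_gt0// divr_gt0 ?exprn_gt0 ?invr_gt0// ltr_pwDl.
exists c => // x y; set D := 2 * _ + _ - _.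
have scE z : scaled j z ^+ 2 = c * p t z ^+ 2.
  by rewrite /scaled /j choice.pickleK exprMn.
have jge0 i : 0 <= 2 * scaled i x ^+ 2 + 2 * scaled i y ^+ 2 - scaled i (x + y) ^+ 2.
  have := (scaled_seminorm i).1 x y; have := seminorm_ge0 (x + y) (scaled_seminorm i).
  have := seminorm_ge0 x (scaled_seminorm i); have := seminorm_ge0 y (scaled_seminorm i).
  by have := sqr_ge0 (scaled i x - scaled i y); nra.
have key J : partial J (x + y) ^+ 2 <= 2 * l2_sum x ^+ 2 + 2 * l2_sum y ^+ 2 - c * D.
  (* Enlarging the partial sum to [maxn J j.+1] makes it contain the term [j]. *)
  have pm z : partial J z ^+ 2 <= partial (maxn J j.+1) z ^+ 2.
    rewrite !sqr_sqrtr// [leRHS](@big_cat_nat _ _ _ J) ?leq_maxl//= lerDl.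
    by apply: sumr_ge0 => *; exact: sqr_ge0.
  apply: (le_trans (pm _)); set K := maxn J j.+1.
  have pl z : partial K z ^+ 2 <= l2_sum z ^+ 2.
    rewrite lerXn2r ?nnegrE ?sqrtr_ge0//; apply: le_trans (partial_l2_sum K z).
    exact: sqrtr_ge0.
  suff : c * D <= 2 * partial K x ^+ 2 + 2 * partial K y ^+ 2 - partial K (x + y) ^+ 2.
    by have := pl x; have := pl y; lra.
  rewrite !sqr_sqrtr// !mulr_sumr -big_split/= -sumrB.
  rewrite (bigD1_seq j)/= ?iota_uniq ?mem_index_iota ?leq_max ?ltnSn ?orbT//.
  rewrite -[leLHS]addr0 lerD//; first by rewrite !scE /D; lra.
  by apply: sumr_ge0.
have R0 : 0 <= 2 * l2_sum x ^+ 2 + 2 * l2_sum y ^+ 2 - c * D.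
  by apply: le_trans (key 0); exact: sqr_ge0.
have : l2_sum (x + y) <= Num.sqrt (2 * l2_sum x ^+ 2 + 2 * l2_sum y ^+ 2 - c * D).
  apply: l2_sum_le_ub => J; apply: sqr_le_le; first exact: sqrtr_ge0.
  by rewrite [leRHS]sqr_sqrtr.
have l0 := seminorm_ge0 (x + y) l2_sum_seminorm.
move=> h; have : l2_sum (x + y) ^+ 2 <= Num.sqrt (2 * l2_sum x ^+ 2 + 2 * l2_sum y ^+ 2 - c * D) ^+ 2.
  by rewrite lerXn2r ?nnegrE ?sqrtr_ge0.
by rewrite sqr_sqrtr//; lra.
Qed.

End l2_sum_of_seminorms.

(** * Sums of largest terms *)

Section top_sums.
Context (R : realType).
Implicit Types (f g b : nat -> R) (A B : {fset nat}) (j : nat).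

(** A supremum over finite sets instead of a sum along a decreasing rearrangement: invariance under
    permutations is then immediate. The supremum need not be attained, whence the tolerance [eta]
    below. *)
Definition top_sum f j : R :=
  sup [set \sum_(i <- A) f i | A in [set A : {fset nat} | (#|` A| <= j)%N]].

Section bounded.
Context (f : nat -> R) (M : R).
Hypothesis f_ge0 : forall i, 0 <= f i.
Hypothesis f_le : forall i, f i <= M.

Let sum_le_card A : \sum_(i <- A) f i <= #|` A|%:R * M.
Proof.
apply: (@le_trans _ _ (\sum_(i <- A) M)); first by apply: ler_sum.
by rewrite big_const_seq count_predT iter_addr_0 mulr_natl.
Qed.

Let M_ge0 : 0 <= M. Proof. exact: le_trans (f_ge0 0) (f_le 0). Qed.

Lemma top_sum_ge A j : (#|` A| <= j)%N -> \sum_(i <- A) f i <= top_sum f j.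
Proof.
move=> Aj; apply: ub_le_sup; last by exists A.
exists (j%:R * M) => _ [B /= Bj <-]; apply: (le_trans (sum_le_card B)).
by rewrite ler_wpM2r// ler_nat.
Qed.

Lemma top_sum_le j c : (forall A, (#|` A| <= j)%N -> \sum_(i <- A) f i <= c) ->
  top_sum f j <= c.
Proof.
move=> h; apply: sup_le_ub; first by exists 0, fset0 => //=; rewrite big_seq_fset0.
by move=> _ [A /= Aj <-]; exact: h.
Qed.

Lemma top_sum_ge0 j : 0 <= top_sum f j.
Proof. by have := @top_sum_ge fset0 j; rewrite big_seq_fset0 => ->. Qed.

Lemma top_sum_le_card j : top_sum f j <= j%:R * M.
Proof.
apply: top_sum_le => A Aj; apply: (le_trans (sum_le_card A)).
by rewrite ler_wpM2r// ler_nat.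
Qed.

Lemma top_sum_near j eta : 0 < eta ->
  exists2 A, (#|` A| <= j)%N & top_sum f j - eta <= \sum_(i <- A) f i.
Proof.
move=> eta0; apply: contrapT => /forall2NP h.
suff : top_sum f j <= top_sum f j - eta by lra.
apply: top_sum_le => A Aj; have [//|/negP] := h A.
by rewrite -ltNge => /ltW.
Qed.

Lemma top_sum_notin A j i : (#|` A| <= j)%N -> i \notin A ->
  f i + \sum_(k <- A) f k <= top_sum f j.+1.
Proof.
move=> Aj iA; rewrite -big_fsetU1//; apply: top_sum_ge.
by rewrite cardfsU1 iA.
Qed.

(* Exchange: move one element of [A `\` B] from [A] to [B]. *)
Lemma top_sum_unique A B j eta : (#|` A| <= j.+1)%N -> (#|` B| <= j.+1)%N ->
  top_sum f j.+1 - eta <= \sum_(i <- A) f i ->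
  top_sum f j.+1 - eta <= \sum_(i <- B) f i ->
  top_sum f j + top_sum f j.+2 + 2 * eta < 2 * top_sum f j.+1 -> A = B.
Proof.
have half (C D : {fset nat}) : (#|` C| <= j.+1)%N -> (#|` D| <= j.+1)%N ->
    top_sum f j.+1 - eta <= \sum_(i <- C) f i ->
    top_sum f j.+1 - eta <= \sum_(i <- D) f i ->
    top_sum f j + top_sum f j.+2 + 2 * eta < 2 * top_sum f j.+1 -> (C `<=` D)%fset.
  move=> Cj Dj hC hD gap; apply/fsubsetP => i iC; apply: contrapT => /negP iD.
  have := top_sum_notin Dj iD.
  have : \sum_(k <- (C `\ i)%fset) f k <= top_sum f j.
    by apply: top_sum_ge; move: Cj; rewrite (cardfsD1 i) iC.
  by move: hC; rewrite (big_fsetD1 i)//=; lra.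
by move=> *; apply/eqP; rewrite eqEfsubset !half.
Qed.

End bounded.

Lemma top_sumS f g M j : (forall i, 0 <= f i) -> (forall i, f i <= g i) ->
  (forall i, g i <= M) -> top_sum f j <= top_sum g j.
Proof.
move=> f0 fg gM; apply: top_sum_le => A Aj.
apply: (@le_trans _ _ (\sum_(i <- A) g i)); first exact: ler_sum.
by apply: (@top_sum_ge _ M) => // i; exact: le_trans (fg i).
Qed.

Lemma top_sum_bij f j (sigma : nat -> nat) : bijective sigma ->
  top_sum (f \o sigma) j = top_sum f j.
Proof.
move=> bs; have [tau st ts] := bs; congr sup; apply/seteqP.
have tr (g : nat -> R) (s : nat -> nat) : injective s ->
    [set \sum_(i <- A) (g \o s) i | A in [set A : {fset nat} | (#|` A| <= j)%N]] `<=`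
    [set \sum_(i <- A) g i | A in [set A : {fset nat} | (#|` A| <= j)%N]].
  move=> s_inj _ [A /= Aj <-]; exists [fset s i | i in A]%fset => /=.
    by rewrite card_imfset.
  by rewrite big_imfset//= => ? ? _ _; exact: s_inj.
split; first exact: tr (bij_inj bs).
rewrite [X in X `<=` _](_ : _ = [set \sum_(i <- A) ((f \o sigma) \o tau) i | A in
    [set A : {fset nat} | (#|` A| <= j)%N]]); first exact: tr (can_inj ts).
by apply: eq_imagel => A _; apply: eq_bigr => i _ /=; rewrite ts.
Qed.

Lemma ler_sum_subset (I : eqType) (s1 s2 : seq I) (f : I -> R) :
  (forall i, 0 <= f i) -> uniq s1 -> uniq s2 -> {subset s1 <= s2} ->
  \sum_(i <- s1) f i <= \sum_(i <- s2) f i.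
Proof.
move=> f0 u1 u2 s12.
have s1E : perm_eq s1 [seq i <- s2 | i \in s1].
  apply: uniq_perm => //; first exact: filter_uniq.
  move=> i; rewrite mem_filter andb_idr//; exact: s12.
rewrite (perm_big _ s1E)/= big_filter big_mkcond/=.
by apply: ler_sum => i _; case: ifP.
Qed.

Lemma top_sum_ge_prefix f M j : (forall i, 0 <= f i) -> (forall i, f i <= M) ->
  \sum_(0 <= i < j) f i <= top_sum f j.
Proof.
move=> f0 fM; pose A := [fset i in iota 0 j]%fset.
apply: (@le_trans _ _ (\sum_(i <- A) f i)).
  apply: ler_sum_subset => //; [exact: iota_uniq|exact: fset_uniq|].
  by move=> i; rewrite mem_index_iota !inE mem_iota.
apply: (top_sum_ge f0 fM); rewrite card_fseq undup_id ?iota_uniq//.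
by rewrite size_iota.
Qed.

Lemma top_sum_nonincreasing b j : (forall i, 0 <= b i) ->
  {homo b : i k / (i <= k)%N >-> k <= i} ->
  top_sum b j <= 2 * \sum_(0 <= i < j) b i.
Proof.
move=> b0 bm; apply: (@top_sum_le _) => A Aj.
rewrite (bigID (fun i => (i < j)%N))/= [2 * _]mulr_natl [_ *+ 2]mulr2n; apply: lerD.
  rewrite -big_filter; apply: ler_sum_subset => //.
  - by apply: filter_uniq; exact: fset_uniq.
  - exact: iota_uniq.
  - by move=> i; rewrite mem_filter mem_index_iota => /andP[].
apply: (@le_trans _ _ (\sum_(i <- A) b j)).
  rewrite big_mkcond/=; apply: ler_sum => i _.
  by case: ltnP => //= ji; exact: bm.
rewrite big_const_seq count_predT iter_addr_0.
apply: (@le_trans _ _ (b j *+ j)); first by rewrite -[leLHS]mulr_natr -[leRHS]mulr_natr ler_wpM2l// ler_nat.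
rewrite -[X in _ *+ X]subn0 -sumr_const_nat.
by apply: ler_sum_nat => i /andP[_ /ltnW]; exact: bm.
Qed.

(** Only the first [n] indices are permuted, so that the rearranged sequence again vanishes from [n]
    on. *)
Lemma sort_nonincreasing (a : nat -> R) n : (forall i, 0 <= a i) ->
  (forall i, (n <= i)%N -> a i = 0) ->
  exists2 sigma : nat -> nat, bijective sigma &
    {homo a \o sigma : i k / (i <= k)%N >-> k <= i} /\
    forall i, (n <= i)%N -> sigma i = i.
Proof.
move=> a0 an; pose le_a i j := a j <= a i.
pose s := sort le_a (iota 0 n).
have ss : size s = n by rewrite size_sort size_iota.
have us : uniq s by rewrite sort_uniq iota_uniq.
have ms i : (i \in s) = (i < n)%N by rewrite mem_sort mem_iota add0n.
have sorted_s : sorted le_a s by apply: sort_sorted => i j; exact: le_total.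
pose sigma i := if (i < n)%N then nth 0%N s i else i.
pose tau i := if (i < n)%N then index i s else i.
have sigma_lt i : (i < n)%N -> (nth 0%N s i < n)%N.
  by move=> i_n; rewrite -ms mem_nth// ss.
exists sigma; [exists tau|split].
- move=> i; rewrite /tau /sigma; case: (ltnP i n) => i_n.
    by rewrite sigma_lt// index_uniq// ss.
  by rewrite ltnNge i_n.
- move=> i; rewrite /tau /sigma; case: (ltnP i n) => i_n.
    have : (index i s < n)%N by rewrite -[X in (_ < X)%N]ss index_mem ms.
    by move=> ->; rewrite nth_index// ms.
  by rewrite ltnNge i_n.
- move=> i k ik; rewrite /sigma /=; case: (ltnP k n) => k_n.
    rewrite (leq_ltn_trans ik k_n).
    apply: (@sorted_leq_nth _ le_a _ _ 0%N s sorted_s) => //.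
    + by move=> x y z; rewrite /le_a => yx zy; exact: le_trans yx.
    + by move=> x; rewrite /le_a.
    + by rewrite inE ss (leq_ltn_trans ik).
    + by rewrite inE ss.
  by rewrite (an k).
- by move=> i; rewrite /sigma ltnNge => ->.
Qed.

Definition power_average b m k : R := (\sum_(0 <= i < m ^ k) b i) / (m ^ k)%:R.

(* Splitting the average at [m ^ k] gives
   [power_average b m k.+1 <= power_average b m k / m + b (m ^ k)]. *)
Lemma power_average_le b m k i : (1 < m)%N -> (forall i, 0 <= b i) ->
  {homo b : i k / (i <= k)%N >-> k <= i} -> (i < m ^ k.+1)%N ->
  power_average b m k <= \sum_(0 <= l < k.+1) m%:R^-1 ^+ l * b (i %/ m ^ l.+2)%N.
Proof.
move=> m1 b0 bm; have m0 : (0 < m)%N by exact: ltnW.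
elim: k i => [|k ih] i im.
  rewrite /power_average expn0 !big_nat1 divr1 expr0 mul1r divn_small//.
  by rewrite (leq_trans im)// leq_exp2l.
rewrite big_nat_recl//= expr0 mul1r.
(* The terms of positive index in the sum for [i] are [m%:R^-1] times the sum for [i %/ m], to which
   the induction hypothesis applies. *)
have im1 : (i %/ m < m ^ k.+1)%N by rewrite ltn_divLR// -expnSr.
have := ih _ im1; set S := \sum_(0 <= l < k.+1) _ => hS.
rewrite [X in _ <= _ + X](_ : _ = m%:R^-1 * S); last first.
  rewrite mulr_sumr; apply: eq_bigr => l _.
  by rewrite exprS mulrA -divnMA -expnS.
have {}hS : m%:R^-1 * power_average b m k <= m%:R^-1 * S.
  by rewrite ler_wpM2l// invr_ge0.
apply: (le_trans _ (lerD (lexx _) hS)).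
have mk0 : 0 < (m ^ k.+1)%:R :> R by rewrite ltr0n expn_gt0 m0.
rewrite /power_average ler_pdivrMr// mulrDl.
rewrite (@big_cat_nat _ _ _ (m ^ k))/= ?leq_exp2l//.
rewrite addrC; apply: lerD.
  (* Every index of this block is at least [m ^ k], which exceeds [i %/ m ^ 2]. *)
  apply: (@le_trans _ _ (\sum_(m ^ k <= j < m ^ k.+1) b (i %/ m ^ 2)%N)).
    apply: ler_sum_nat => j /andP[kj _]; apply: bm; apply: leq_trans kj.
    by rewrite ltnW// ltn_divLR ?expn_gt0 ?m0// -expnD addn2.
  rewrite sumr_const_nat -[leLHS]mulr_natr ler_wpM2l// ler_nat; exact: leq_subr.
rewrite expnS natrM; set c := (m ^ k)%:R.
have c0 : c != 0 :> R by rewrite pnatr_eq0 -lt0n expn_gt0 m0.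
have m0' : m%:R != 0 :> R by rewrite pnatr_eq0 -lt0n.
by rewrite le_eqVlt; apply/orP; left; apply/eqP; field; rewrite c0.
Qed.

End top_sums.

(** * Symmetric bases *)

Section symmetric_basis.
Context (R : realType) (X : completeNormedModType R) (e : nat -> X) (K : R).
Hypothesis symK : K_symmetric K e.
Implicit Types (a b : nat -> R) (x y : X).

Local Notation co := (coords e).

Definition expands a x := series (fun n => a n *: e n) @ \oo --> x.
Definition comb a n : X := \sum_(0 <= i < n) a i *: e i.
Definition cut n a : nat -> R := fun i => if (i < n)%N then a i else 0.

Let K_ge1 : 1 <= K. Proof. by case: symK. Qed.
Let K_ge0 : 0 <= K. Proof. exact: le_trans ler01 K_ge1. Qed.

Lemma coords_expands x : expands (co x) x.
Proof.
have [_ be _] := symK; have [a [ax _]] := be x.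
exact: (@xgetPex _ (fun=> 0) [set a : nat -> R | expands a x]) (ex_intro _ a ax).
Qed.
Arguments coords_expands : clear implicits.

Lemma expands_coords a x : expands a x -> co x = a.
Proof.
have [_ be _] := symK; have [c [_ cuniq]] := be x.
by move=> ax; rewrite -(cuniq _ ax) -(cuniq _ (coords_expands x)).
Qed.

Lemma coords_inj x y : co x = co y -> x = y.
Proof.
move=> xy; have := coords_expands y; rewrite -xy.
exact: (cvg_unique (@norm_hausdorff _ _) (coords_expands x)).
Qed.

Lemma coordsD x y i : co (x + y) i = co x i + co y i.
Proof.
rewrite (@expands_coords (fun i => co x i + co y i))//.
rewrite /expands [series _](_ : _ =
  series (fun n => co x n *: e n) + series (fun n => co y n *: e n)).
  by apply: cvgD; exact: coords_expands.
apply/funext => n; rewrite fctE /series /= -big_split/=.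
by apply: eq_bigr => k _; rewrite scalerDl.
Qed.

Lemma coordsZ t x i : co (t *: x) i = t * co x i.
Proof.
rewrite (@expands_coords (fun i => t * co x i))//.
rewrite /expands [series _](_ : _ = t \*: series (fun n => co x n *: e n)).
  by apply: cvgZr; exact: coords_expands.
apply/funext => n; rewrite /series /= scaler_sumr.
by apply: eq_bigr => k _; rewrite scalerA.
Qed.

Lemma coordsN x i : co (- x) i = - co x i.
Proof. by rewrite -scaleN1r coordsZ mulN1r. Qed.

Lemma coordsB x y i : co (x - y) i = co x i - co y i.
Proof. by rewrite coordsD coordsN. Qed.

Lemma comb_expands a n : expands (cut n a) (comb a n).
Proof.
apply: (@cvg_near_cst _ _ _ _ _) => //.
near=> k; have nk : (n <= k)%N by near: k; exact: nbhs_infty_ge.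
rewrite /series /= (@big_cat_nat _ _ _ n)//= [X in _ + X](_ : _ = 0) ?addr0.
  by apply: eq_big_nat => i /andP[_ i_n]; rewrite /cut i_n.
rewrite big_nat_cond; apply: big1 => i; rewrite andbT => /andP[ni _].
by rewrite /cut ltnNge ni scale0r.
Unshelve. all: by end_near. Qed.

Arguments comb_expands : clear implicits.

Lemma coords_comb a n : co (comb a n) = cut n a.
Proof. by apply: expands_coords; exact: comb_expands. Qed.

Lemma comb_eq a b n : (forall i, (i < n)%N -> a i = b i) -> comb a n = comb b n.
Proof. by move=> ab; apply: eq_big_nat => i /andP[_ /ab ->]. Qed.

Lemma norm_sign_perm a x (s : nat -> bool) (sigma : nat -> nat) : bijective sigma ->
  expands a x -> exists2 y, expands (fun n => (-1) ^+ s n * a (sigma n)) y & `|y| <= K * `|x|.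
Proof. by case: symK => _ _ h bs ax; exact: h. Qed.

Lemma norm_comb_sign a n (s : nat -> bool) :
  `|comb (fun i => (-1) ^+ s i * a i) n| <= K * `|comb a n|.
Proof.
have [y /expands_coords yE yK] := norm_sign_perm s (@Bijective _ _ id id (fun=> erefl) (fun=> erefl)) (comb_expands a n).
suff <- : y = comb (fun i => (-1) ^+ s i * a i) n by [].
apply: coords_inj; rewrite yE coords_comb; apply/funext => i.
by rewrite /cut; case: ifP => //; rewrite mulr0.
Qed.

(** Convexity: [b n] is a convex combination of [a n] and [- a n], so a bound at both signs holds at
    [b n]. The vector [z] collects the coordinates already replaced, the last one first. *)
Lemma norm_comb_sign_extreme a b n (z : X) M : (forall i, `|b i| <= `|a i|) ->
  (forall s : nat -> bool, `|z + comb (fun i => (-1) ^+ s i * a i) n| <= M) ->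
  `|z + comb b n| <= M.
Proof.
move=> ba; elim: n z => [|n ih] z hs.
  by have := hs xpredT; rewrite /comb !big_geq.
rewrite /comb big_nat_recr//= [_ + b n *: _]addrC addrA; apply: ih => s.
set w := comb _ n.
have sgn (t : bool) : `|z + w + ((-1) ^+ t * a n) *: e n| <= M.
  have := hs (fun i => if (i < n)%N then s i else t).
  rewrite /comb big_nat_recr//= ltnn addrA -/(comb _ n).
  rewrite (@comb_eq _ (fun i => (-1) ^+ s i * a i))// => i i_n; first by rewrite i_n.
have [an0|an0] := eqVneq (a n) 0.
  have := ba n; rewrite an0 normr0 normr_le0 => /eqP ->.
  by have := sgn true; rewrite an0 mulr0 !scale0r !addr0.
have bn : `|b n / a n| <= 1 by rewrite normf_div ler_pdivrMr ?normr_gt0 ?mul1r.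
set u := b n / a n in bn; have := bn; rewrite ler_norml => /andP[u1 u2].
have split_uc (Z E : X) (c : R) : Z + (u * c) *: E =
    ((1 + u) / 2) *: (Z + ((-1) ^+ false * c) *: E) +
    ((1 - u) / 2) *: (Z + ((-1) ^+ true * c) *: E).
  rewrite !scalerDr addrACA -scalerDl -mulrDl !scalerA -scalerDl.
  rewrite (_ : (1 + u + (1 - u)) / 2 = 1); last by field.
  by rewrite scale1r expr0 expr1; congr (_ + _ *: _); field.
rewrite addrAC -[b n](divfK an0) -/u split_uc.
apply: (le_trans (ler_normD _ _)); rewrite normrZ [X in _ + X]normrZ.
rewrite ger0_norm ?divr_ge0//; last by lra.
rewrite ger0_norm ?divr_ge0//; last by lra.
apply: (@le_trans _ _ ((1 + u) / 2 * M + (1 - u) / 2 * M)); last by lra.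
by apply: lerD; (apply: ler_wpM2l; [lra|exact: sgn]).
Qed.

Lemma norm_comb_le a b n : (forall i, (i < n)%N -> `|b i| <= `|a i|) ->
  `|comb b n| <= K * `|comb a n|.
Proof.
move=> ba; rewrite (@comb_eq b (cut n b)); last by move=> i i_n; rewrite /cut i_n.
rewrite -[comb _ _]add0r; apply: (@norm_comb_sign_extreme a) => [i|s].
  by rewrite /cut; case: ifP => [|_]; [exact: ba|rewrite normr0].
by rewrite add0r; exact: norm_comb_sign.
Qed.

(** Each block of the series of [b] is bounded by [K] times the same block of the series of [a], so
    the Cauchy criterion passes from one to the other. *)
Lemma expands_dominated a b x : (forall i, `|b i| <= `|a i|) -> expands a x ->
  exists2 y, expands b y & `|y| <= K * `|x|.
Proof.
move=> ba ax.
have cb : cvgn (comb b).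
  apply/cauchy_cvgP/cauchy_seriesP => eps eps0.
  have /cauchy_seriesP/(_ (eps / K)) : cauchy (comb a @ \oo).
    by apply: cvg_cauchy; apply: cvgP ax.
  rewrite divr_gt0//; last exact: lt_le_trans K_ge1.
  move=> /(_ isT); apply: filterS => -[p q] /=.
  rewrite ltr_pdivlMr; last exact: lt_le_trans K_ge1.
  apply: le_lt_trans; rewrite mulrC.
  pose restr (c : nat -> R) i := if (p <= i)%N then c i else 0.
  have restrE c : \sum_(p <= i < q) c i *: e i = comb (restr c) q.
    have [pq|qp] := leqP p q; last first.
      rewrite big_geq 1?ltnW// /comb big_nat_cond big1// => i.
      rewrite andbT => /andP[_ iq].
      by rewrite /restr leqNgt (ltn_trans iq qp)/= scale0r.
    rewrite /comb (@big_cat_nat _ _ _ p 0)//= [X in X + _](_ : _ = 0) ?add0r.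
      by apply: eq_big_nat => i /andP[pi _]; rewrite /restr pi.
    rewrite big_nat_cond; apply: big1 => i; rewrite andbT => /andP[_ ip].
    by rewrite /restr leqNgt ip/= scale0r.
  rewrite !restrE; apply: norm_comb_le => i _.
  by rewrite /restr; case: ifP => // _; exact: ba.
exists (limn (comb b)) => //.
have cx : (fun n => K * `|comb a n|) @ \oo --> K * `|x|.
  by apply: cvgM; [exact: cvg_cst|apply: cvg_norm; exact: ax].
by apply: (ler_cvg_to (cvg_norm cb) cx); apply: nearW => n; exact: norm_comb_le.
Qed.

Lemma dominated_norm x y : (forall i, `|co y i| <= `|co x i|) -> `|y| <= K * `|x|.
Proof.
move=> yx; have [z /expands_coords zE zx] := expands_dominated yx (coords_expands x).
by rewrite (coords_inj (etrans (erefl _) (esym zE))).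
Qed.

Lemma e_neq0 i : e i != 0.
Proof.
apply/eqP => e0; have := coords_comb (fun k => (k == i)%:R) i.+1.
have -> : comb (fun k => (k == i)%:R) i.+1 = comb (fun=> 0) i.+1.
  apply: eq_big_nat => k _; case: eqP => [->|_]; last by [].
  by rewrite e0 !scaler0.
by rewrite coords_comb => /(congr1 (@^~ i)); rewrite /cut ltnSn eqxx => /eqP; rewrite eq_sym oner_eq0.
Qed.

End symmetric_basis.
Arguments coords_expands {R X e K} symK x.
Arguments comb_expands {R X e} a n.

Lemma linear_le_continuous (R : realType) (X : normedModType R) (f : X -> R^o) (C : R) :
  linear f -> (forall x, `|f x| <= C * `|x|) -> continuous f.
Proof.
move=> lin fC.
pose g : {linear X -> R^o} := HB.pack f (GRing.isLinear.Build _ _ _ _ _ lin).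
have bg : bounded_near g (nbhs 0).
  apply/linear_boundedP; exists C; split; first exact: num_real.
  by move=> r rC x; apply: (le_trans (fC x)); rewrite ler_wpM2r// ltW.
exact: (bounded_linear_continuous bg).
Qed.

(** * Coordinate functionals, tails and an equivalent monotone norm *)

Section lattice_norm.
Context (R : realType) (X : completeNormedModType R) (e : nat -> X) (K : R).
Hypothesis symK : K_symmetric K e.
Implicit Types (a b : nat -> R) (x y : X).

Local Notation co := (coords e).
Local Notation comb := (comb e).

Let K_ge1 : 1 <= K. Proof. by case: symK. Qed.
Let K_ge0 : 0 <= K. Proof. exact: le_trans ler01 K_ge1. Qed.

Lemma coords0 i : co 0 i = 0.
Proof. by rewrite -(scale0r 0) (coordsZ symK) mul0r. Qed.

Lemma coords_e i k : co (e i) k = (k == i)%:R.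
Proof.
have -> : e i = comb (fun k => (k == i)%:R) i.+1.
  rewrite /comb big_nat_recr//= eqxx scale1r big_nat_cond big1 ?add0r// => j.
  by rewrite andbT => /andP[_ ji]; rewrite lt_eqF ?scale0r.
rewrite (coords_comb symK) /cut; case: ltnP => // ki.
by rewrite gtn_eqF.
Qed.

Lemma norm_rearranged_le x y (sigma : nat -> nat) : bijective sigma ->
  (forall i, `|co y i| = `|co x (sigma i)|) -> `|y| <= K * `|x|.
Proof.
move=> bs yx; pose s i := co y i != co x (sigma i).
have [z /(expands_coords symK) zE zx] := norm_sign_perm symK s bs (coords_expands symK x).
rewrite (_ : y = z)//; apply: (coords_inj symK); rewrite zE; apply/funext => i.
rewrite /s; case: eqVneq => [->|ne]; first by rewrite expr0 mul1r.
have /eqP := yx i; rewrite eqr_norm2 (negPf ne)/= => /eqP ->.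
by rewrite expr1 mulN1r.
Qed.

Lemma exists_rearranged x (sigma : nat -> nat) : bijective sigma ->
  exists y, forall i, co y i = `|co x (sigma i)|.
Proof.
move=> bs; pose s i := co x (sigma i) < 0.
have [z /(expands_coords symK) zE _] := norm_sign_perm symK s bs (coords_expands symK x).
exists z => i; rewrite zE /s; case: ltP => c0.
  by rewrite expr1 mulN1r ltr0_norm.
by rewrite expr0 mul1r ger0_norm.
Qed.

(** One factor [K] pays for the projection onto a single coordinate, the other for carrying it to
    [e 0] by a transposition. *)
Definition coord_bound : R := K * (K / `|e 0|).

Lemma coord_bound_gt0 : 0 < coord_bound.
Proof.
have K0 : 0 < K := lt_le_trans ltr01 K_ge1.
by rewrite !(mulr_gt0, invr_gt0) ?normr_gt0 ?(e_neq0 symK).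
Qed.

Lemma coord_le x i : `|co x i| <= coord_bound * `|x|.
Proof.
have h1 : `|co x i *: e i| <= K * `|x|.
  apply: (dominated_norm symK) => k; rewrite (coordsZ symK) coords_e normrM.
  by case: eqVneq => [->|_]; rewrite ?normr1 ?mulr1 ?normr0 ?mulr0.
pose sw k := if k == 0%N then i else if k == i then 0%N else k.
have sw_inv : cancel sw sw.
  move=> k; rewrite /sw; case: (eqVneq k 0%N) => [->|k0].
    by case: (eqVneq i 0%N) => [->|i0]; rewrite ?eqxx.
  case: (eqVneq k i) => [->|ki]; first by rewrite eqxx.
  by rewrite (negPf k0) (negPf ki).
have h2 : `|co x i *: e 0%N| <= K * `|co x i *: e i|.
  apply: (norm_rearranged_le (Bijective sw_inv sw_inv)) => k.
  rewrite !(coordsZ symK) !coords_e; congr (`|_ * _%:R|); congr nat_of_bool.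
  rewrite /sw; case: (eqVneq k 0%N) => [_|k0]; first by rewrite eqxx.
  case: (eqVneq k i) => [ki|ki]; last by rewrite (negPf ki).
  by rewrite -ki eq_sym (negPf k0).
rewrite /coord_bound -!mulrA [_^-1 * _]mulrC !mulrA ler_pdivlMr ?normr_gt0 ?(e_neq0 symK)//.
rewrite -normrZ; apply: (le_trans h2); rewrite -mulrA ler_wpM2l//.
Qed.

Definition tail k x := x - comb (co x) k.

Lemma coords_tail k x i : co (tail k x) i = if (i < k)%N then 0 else co x i.
Proof.
rewrite (coordsB symK) (coords_comb symK) /cut.
by case: ifP => _; rewrite ?subrr ?subr0.
Qed.

Lemma tailD k x y : tail k (x + y) = tail k x + tail k y.
Proof.
apply: (coords_inj symK); apply/funext => i.
by rewrite (coordsD symK) !coords_tail (coordsD symK); case: ifP; rewrite ?addr0.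
Qed.

Lemma tailZ k t x : tail k (t *: x) = t *: tail k x.
Proof.
apply: (coords_inj symK); apply/funext => i.
by rewrite (coordsZ symK) !coords_tail (coordsZ symK); case: ifP; rewrite ?mulr0.
Qed.

Lemma tail0 x : tail 0 x = x.
Proof. by rewrite /tail /comb big_geq// subr0. Qed.

Lemma tail_cvg x : (fun k => tail k x) @ \oo --> 0.
Proof.
rewrite -(subrr x); apply: cvgB; first exact: cvg_cst.
exact: (coords_expands symK x).
Qed.

Lemma norm_tail k x : `|tail k x| <= K * `|x|.
Proof.
apply: (dominated_norm symK) => i; rewrite coords_tail.
by case: ifP; rewrite ?normr0.
Qed.

(* The operator [hardy] below is only coordinatewise subadditive, so the norm
   composed with it has to be monotone. *)
Definition lattice_norm x : R := sup [set `|y| | y in [set y | forall i, `|co y i| <= `|co x i|]].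

Lemma lattice_norm_ge x y : (forall i, `|co y i| <= `|co x i|) -> `|y| <= lattice_norm x.
Proof.
move=> yx; apply: ub_le_sup; last by exists y.
by exists (K * `|x|) => _ [z zx <-]; exact: (dominated_norm symK).
Qed.

Lemma lattice_norm_le_ub x M : (forall y, (forall i, `|co y i| <= `|co x i|) -> `|y| <= M) ->
  lattice_norm x <= M.
Proof.
move=> h; apply: sup_le_ub; first by exists `|x|, x => /=.
by move=> _ [y yx <-]; exact: h.
Qed.

Lemma norm_le_lattice x : `|x| <= lattice_norm x.
Proof. exact: lattice_norm_ge. Qed.

Lemma lattice_norm_le x : lattice_norm x <= K * `|x|.
Proof. by apply: lattice_norm_le_ub => y; exact: (dominated_norm symK). Qed.

Lemma lattice_norm_mono x y : (forall i, `|co y i| <= `|co x i|) ->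
  lattice_norm y <= lattice_norm x.
Proof.
move=> yx; apply: lattice_norm_le_ub => z zy; apply: lattice_norm_ge => i.
exact: le_trans (yx i).
Qed.

Lemma lattice_norm_seminorm : seminorm lattice_norm.
Proof.
apply: seminorm_of_le => [x|x y|s z].
- exact: le_trans (normr_ge0 _) (norm_le_lattice x).
- apply: lattice_norm_le_ub => z zxy.
  (* Riesz decomposition: [z] is shared between [x] and [y] in proportion to their moduli. Where
     both moduli vanish so does [z], and the quotient is zero by convention. *)
  pose b i := co z i * (`|co x i| / (`|co x i| + `|co y i|)).
  have zi i : `|co z i| <= `|co x i| + `|co y i|.
    by apply: (le_trans (zxy i)); rewrite (coordsD symK) ler_normD.
  have bx i : `|b i| <= `|co x i|.
    rewrite /b; have [d0|d0] := eqVneq (`|co x i| + `|co y i|) 0.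
      by rewrite d0 invr0 !mulr0 normr0.
    rewrite normrM normf_div normr_id (ger0_norm (addr_ge0 _ _))// mulrCA.
    by rewrite ler_piMr// ler_pdivrMr ?mul1r// lt0r d0 addr_ge0.
  have [u /(expands_coords symK) uE _] := expands_dominated symK bx (coords_expands symK x).
  rewrite -(subrK u z) addrC; apply: (le_trans (ler_normD _ _)); apply: lerD.
    by apply: lattice_norm_ge => i; rewrite uE.
  apply: lattice_norm_ge => i; rewrite (coordsB symK) uE /b.
  have [d0|d0] := eqVneq (`|co x i| + `|co y i|) 0.
    by rewrite d0 invr0 !mulr0 subr0; have := zi i; rewrite d0; have := normr_ge0 (co y i); lra.
  rewrite -{1}[co z i]mulr1 -mulrBr -{1}(divff d0) -mulrBl [_ + _ - _]addrC addKr.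
  rewrite normrM normf_div normr_id (ger0_norm (addr_ge0 _ _))// mulrCA.
  by rewrite ler_piMr// ler_pdivrMr ?mul1r// lt0r d0 addr_ge0.
- have [->|s0] := eqVneq s 0.
    rewrite scale0r normr0 mul0r; apply: (le_trans (lattice_norm_le _)).
    by rewrite normr0 mulr0.
  apply: lattice_norm_le_ub => u uz.
  rewrite -ler_pdivrMl ?normr_gt0// -normfV -normrZ; apply: lattice_norm_ge => i.
  rewrite (coordsZ symK) normrM normfV ler_pdivrMl ?normr_gt0//.
  by have := uz i; rewrite (coordsZ symK) normrM.
Qed.

Lemma coords_dual i : dual_space (fun x => co x i : R^o).
Proof.
have lin : linear (fun x => co x i : R^o).
  by move=> t x y; rewrite (coordsD symK) (coordsZ symK).
by split=> //; exact: (linear_le_continuous lin (coord_le^~ i)).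
Qed.

End lattice_norm.

(** * Reflexivity and convex combinations *)

Lemma ultra_fmap (T U : Type) (F : set_system T) (f : T -> U) :
  UltraFilter F -> UltraFilter (f @ F).
Proof.
move=> FU; split=> [|G GF FG]; first exact: fmap_proper_filter.
apply/seteqP; split=> // A GA.
have [//|FA] := in_ultra_setVsetC (f @^-1` A) FU.
have GA' : G (~` A) by apply: FG.
by exfalso; apply: (@filter_not_empty _ G _); rewrite -(setICr A); exact: filterI.
Qed.

Section reflexive.
Context (R : realType) (X : normedModType R).
Hypothesis refl_X : reflexive_space X.

Let dual_bound (f : X -> R^o) : dual_space f -> exists2 r : R,
  0 <= r & opnorm f = r%:E /\ forall x, `|f x| <= r * `|x|.
Proof.
move=> [lin cont].
pose g : {linear X -> R^o} := HB.pack f (GRing.isLinear.Build _ _ _ _ _ lin).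
have [C [_ gC]] : \forall r \near +oo, forall x, `|g x| <= r * `|x|.
  by apply/linear_boundedP/linear_bounded_continuous.
have {}gC x : `|f x| <= (C + 1) * `|x| by apply: gC; rewrite ltrDl.
have f0 : f 0 = 0 := linear0 g.
have op_ub : (opnorm f <= (`|C + 1|)%:E)%E.
  apply: ge_ereal_sup => _ [x /= x1 <-]; rewrite lee_fin.
  apply: (le_trans (gC x)); rewrite -[leRHS]mulr1.
  by rewrite (le_trans (ler_wpM2r _ (ler_norm _)))// ler_wpM2l.
have op_ge x : `|x| <= 1 -> (`|f x|%:E <= opnorm f)%E.
  by move=> x1; apply: ereal_sup_ubound; exists x.
have op_fin : opnorm f \is a fin_num.
  rewrite ge0_fin_numE; first exact: le_lt_trans op_ub (ltry _).
  by apply: le_trans (op_ge 0 _); rewrite ?normr0// lee_fin.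
exists (fine (opnorm f)).
  by apply: fine_ge0; apply: le_trans (op_ge 0 _); rewrite ?normr0// lee_fin.
split=> [|x]; first by rewrite fineK.
have [->|x0] := eqVneq x 0; first by rewrite f0 !normr0 mulr0.
have nx : 0 < `|x| by rewrite normr_gt0.
have := op_ge (`|x|^-1 *: x); rewrite normrZ normfV normr_id mulVf ?gt_eqF//.
move=> /(_ (lexx _)); rewrite -(fineK op_fin) lee_fin.
have := lin `|x|^-1 x 0; rewrite f0 !addr0 => ->.
by rewrite normrZ normfV normr_id ler_pdivrMl// mulrC.
Qed.

(** Limits along an ultrafilter finer than [\oo] exist for all bounded scalar sequences and depend
    linearly on the functional. They form an element of the bidual, which reflexivity represents by
    [x]. Lower bounds suffice later: applied to [f] and [- f] they also recover limits. *)
Lemma reflexive_weak_limit (w : nat -> X) (B : R) : (forall n, `|w n| <= B) ->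
  exists x, forall f : X -> R^o, dual_space f -> forall c : R,
    (\forall n \near \oo, c <= f (w n)) -> c <= f x.
Proof.
move=> wB; have [U [UU ooU]] := ultraFilterLemma eventually_filter.
have B0 : 0 <= B := le_trans (normr_ge0 _) (wB 0%N).
pose phi (f : X -> R^o) : R := lim (f \o w @ U).
have phi_cvg f : dual_space f -> f \o w @ U --> phi f.
  move=> /dual_bound[r r0 [_ fr]].
  have := @segment_compact R (- (r * B)) (r * B).
  rewrite compact_ultra => /(_ _ (ultra_fmap (f \o w) UU)).
  case=> [|l [_ fl]]; last by apply/cvg_ex; exists l.
  apply: (@filterE nat U) => n /=; rewrite in_itv/= -ler_norml.
  by apply: (le_trans (fr _)); rewrite ler_wpM2l.
have [|x phix] := refl_X (phi := phi).
  split=> [a f g df dg|].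
    apply/cvg_lim => //=; apply: cvgD; last exact: phi_cvg.
    by apply: cvgM; [exact: cvg_cst|exact: phi_cvg].
  exists B => f df; have [r r0 [-> fr]] := dual_bound df.
  rewrite -EFinM lee_fin mulrC.
  apply: (cvgr_to_le (cvg_norm (phi_cvg f df))); apply: (@filterE nat U) => n /=.
  by apply: (le_trans (fr _)); rewrite ler_wpM2l.
exists x => f df c cf; rewrite -phix//.
by apply: (cvgr_to_ge (phi_cvg f df)); exact: ooU.
Qed.

(** The pairs [(w n, delta)] generate a convex cone on which the hypothesis bounds the second
    component by [p] of the first. Hahn-Banach gives one functional [f] below [p] and at least
    [delta] on every [w n]; hence [delta <= f x <= p x] at the weak limit. *)
Lemma reflexive_convex_lower_bound (w : nat -> X) (B C delta : R) (p : X -> R) :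
  (forall n, `|w n| <= B) -> seminorm p -> (forall x, p x <= C * `|x|) ->
  (forall r (lam : nat -> R), (forall i, 0 <= lam i) ->
    delta * \sum_(0 <= i < r) lam i <= p (\sum_(0 <= i < r) lam i *: w i)) ->
  exists2 x, delta <= p x & forall f : X -> R^o, dual_space f -> forall c : R,
    (\forall n \near \oo, c <= f (w n)) -> c <= f x.
Proof.
move=> wB sp pC plow; have [x xlim] := reflexive_weak_limit wB.
pose G := [set g : X * R | exists r (lam : nat -> R), (forall i, 0 <= lam i) /\
  g = (\sum_(0 <= i < r) lam i *: w i, delta * \sum_(0 <= i < r) lam i)].
have [||||_ [r [lam [lam0 ->]]]|f [lin fp fG]] := hahn_banach_cone (p := p) (G := G).
- exact: seminorm_sublinear.
- by exists 0%N, (fun=> 0); split=> //; rewrite !big_geq// mulr0.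
- move=> _ _ [r [lam [lam0 ->]]] [s [mu [mu0 ->]]] /=.
  pose ext k (nu : nat -> R) i := if (i < k)%N then nu i else 0.
  have extE (V : zmodType) k (F : nat -> R -> V) (nu : nat -> R) :
      (k <= maxn r s)%N -> (forall i, F i 0 = 0) ->
      \sum_(0 <= i < k) F i (nu i) = \sum_(0 <= i < maxn r s) F i (ext k nu i).
    move=> kr F0; rewrite [RHS](@big_cat_nat _ _ _ k)//= [X in _ + X](_ : _ = 0).
      by rewrite addr0; apply: eq_big_nat => i /andP[_ ik]; rewrite /ext ik.
    rewrite big_nat_cond; apply: big1 => i; rewrite andbT => /andP[ki _].
    by rewrite /ext ltnNge ki/= F0.
  exists (maxn r s), (fun i => ext r lam i + ext s mu i); split.
    by move=> i; rewrite addr_ge0// /ext; case: ifP.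
  rewrite (extE _ r (fun i t => t *: w i)) ?leq_maxl//; last by move=> i; rewrite scale0r.
  rewrite (extE _ s (fun i t => t *: w i)) ?leq_maxr//; last by move=> i; rewrite scale0r.
  rewrite (extE _ r (fun _ t => t)) ?leq_maxl// (extE _ s (fun _ t => t)) ?leq_maxr//.
  rewrite -mulrDr -!big_split/=; congr (_, _).
  by apply: eq_bigr => i _; rewrite scalerDl.
- move=> t _ t0 [r [lam [lam0 ->]]] /=; exists r, (fun i => t * lam i); split.
    by move=> i; rewrite mulr_ge0.
  rewrite scaler_sumr -mulr_sumr mulrCA; congr (_, _).
  by apply: eq_bigr => i _; rewrite scalerA.
- exact: plow.
have fle y : `|f y| <= C * `|y|.
  rewrite ler_norml (le_trans (fp y) (pC y)) andbT lerNl.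
  have := lin (-1) y 0; rewrite !addr0 !scaleN1r.
  have -> : f 0 = 0 by have := lin (-1) 0 0; rewrite scaleN1r oppr0 addr0 scaleN1r addNr.
  rewrite addr0 => <-; apply: (le_trans (fp _)); apply: (le_trans (pC _)).
  by rewrite normrN.
have df : dual_space f by split=> //; exact: linear_le_continuous fle.
exists x => //; apply: le_trans (fp x); apply: xlim => //.
apply: nearW => n.
have := fG (w n, delta); apply.
exists n.+1, (fun i => (i == n)%:R); split; first by move=> i; rewrite ler0n.
rewrite !big_nat_recr//= eqxx scale1r.
have sum0 (V : zmodType) (F : nat -> V) : (forall i, (i < n)%N -> F i = 0) ->
    \sum_(0 <= i < n) F i = 0.
  by move=> F0; rewrite big_nat_cond big1// => i; rewrite andbT => /andP[_ /F0].
by rewrite !sum0 ?add0r ?mulr1// => i i_n; rewrite (ltn_eqF i_n) ?scale0r.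
Qed.

End reflexive.

(** * Subsequences all of whose convex combinations stay large *)

Section convex_selection.
Context (R : realType) (X : normedModType R) (q : X -> R) (C B : R).
Context (cone : set X) (v : nat -> X).
Hypothesis q_seminorm : seminorm q.
Hypothesis q_le : forall x, q x <= C * `|x|.
Hypothesis v_le : forall n, `|v n| <= B.
Hypothesis coneD : forall c t n, cone c -> 0 <= t -> cone (c + t *: v n).
Hypothesis spread : forall c mu eta, cone c -> 0 <= mu -> 0 < eta ->
  exists M, forall m n s, (M <= m)%N -> (M <= n)%N -> 0 <= s <= 1 ->
    q (c + mu *: v n) - eta <= q (c + (s * mu) *: v m + ((1 - s) * mu) *: v n).

(* A pair [(c, mu)] stands for the convex combinations [c + mu *: v n], where
   the mass [mu] is still to be distributed among later terms. *)
Let good (d : R) (A : set (X * R)) :=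
  [/\ compact A, forall a, A a -> cone a.1 /\ 0 <= a.2 &
      forall a, A a -> \forall n \near \oo, d < q (a.1 + a.2 *: v n)].

Let split (m : nat) (a : X * R * R) : X * R :=
  (a.1.1 + (a.2 * a.1.2) *: v m, (1 - a.2) * a.1.2).

Let next (A : set (X * R)) m := split m @` (A `*` `[0, 1]).

Let split_continuous m : continuous (split m).
Proof.
move=> a.
have c1 : fst b @[b --> a] --> a.1 by exact: cvg_fst.
have c2 : snd b @[b --> a] --> a.2 by exact: cvg_snd.
have c11 : fst (fst b) @[b --> a] --> a.1.1 by apply: (cvg_comp _ _ c1); exact: cvg_fst.
have c12 : snd (fst b) @[b --> a] --> a.1.2 by apply: (cvg_comp _ _ c1); exact: cvg_snd.
have h1 : b.1.1 + (b.2 * b.1.2) *: v m @[b --> a] --> a.1.1 + (a.2 * a.1.2) *: v m.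
  by apply: cvgD => //; apply: cvgZ; [exact: cvgM|exact: cvg_cst].
have h2 : (1 - b.2) * b.1.2 @[b --> a] --> (1 - a.2) * a.1.2.
  by apply: cvgM => //; apply: cvgB => //; exact: cvg_cst.
exact: (cvg_pair h1 h2).
Qed.

(** At one pair this is the hypothesis [spread], and the Lipschitz bound of [q] extends it to a
    small ball around the pair. Compactness of [A] makes the index uniform over all its pairs. *)
Let spread_near (d eta : R) (A : set (X * R)) : good d A -> 0 < eta ->
  \forall m \near \oo, A `<=` [set a | forall s, 0 <= s <= 1 ->
    \forall n \near \oo, d - eta < q (a.1 + (s * a.2) *: v m + ((1 - s) * a.2) *: v n)].
Proof.
move=> [cA coneA gA] eta0; have C0 : 0 < `|C| + 1 by rewrite ltr_wpDl.
have B0 : 0 <= B := le_trans (normr_ge0 _) (v_le 0%N).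
move/compact_near_coveringP : cA.
apply => a Aa; have [ca a2] := coneA _ Aa.
have eta3 : 0 < eta / 2 by rewrite divr_gt0.
have [M hM] := spread ca a2 eta3.
(* Half of [eta] is spent on [spread]; [rho] makes the passage from [a] to [a'] cost at most the
   other half. *)
pose rho := eta / 2 / ((`|C| + 1) * (1 + B)).
have rho0 : 0 < rho by rewrite !(divr_gt0, mulr_gt0)// ltr_wpDr.
exists (ball a rho, [set m | (M <= m)%N]) => /=.
  by split; [exact: nbhsx_ballx|exact: nbhs_infty_ge].
move=> [a' m] /= [[aa1 aa2] Mm] s /andP[s0 s1].
near=> n; have nM : (M <= n)%N by near: n; exact: nbhs_infty_ge.
have dn : d < q (a.1 + a.2 *: v n) by near: n; exact: gA.
have := hM m n s Mm nM; rewrite s0 s1 => /(_ isT) h.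
set z : X := _ + _ + _ in h; set z' : X := _ + _ + _.
have zz' : q z - q z' <= (`|C| + 1) * ((1 + B) * rho).
  apply: (le_trans (seminorm_distr _ _ q_seminorm)); apply: (le_trans (q_le _)).
  apply: (@le_trans _ _ ((`|C| + 1) * `|z - z'|)).
    by rewrite ler_wpM2r// (le_trans (ler_norm _))// lerDl.
  rewrite ler_wpM2l ?(ltW C0)//.
  have -> : z - z' = (a.1 - a'.1) + ((a.2 - a'.2) *: (s *: v m + (1 - s) *: v n)).
    rewrite /z /z' scalerDr !scalerA [(a.2 - a'.2) * s]mulrC [(a.2 - a'.2) * _]mulrC.
    rewrite !mulrBr !scalerBl !opprD [LHS]addrACA.
    by rewrite [X in X + _ = _]addrACA !addrA.
  apply: (le_trans (ler_normD _ _)); rewrite mulrDl mul1r; apply: lerD.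
    by move: aa1; rewrite -ball_normE => /ltW.
  rewrite normrZ mulrC; apply: ler_pM => //.
    apply: (le_trans (ler_normD _ _)); rewrite !normrZ !ger0_norm ?subr_ge0//.
    have := v_le m; have := v_le n; move: `|v m| `|v n| => y x xB yB.
    have : s * y <= s * B by rewrite ler_wpM2l.
    have : (1 - s) * x <= (1 - s) * B by rewrite ler_wpM2l// subr_ge0.
    by lra.
  by move: aa2; rewrite -ball_normE => /ltW.
have rhoE : (`|C| + 1) * ((1 + B) * rho) = eta / 2.
  by rewrite /rho; field; rewrite !gt_eqF// ltr_wpDr.
rewrite rhoE in zz'; lra.
Unshelve. all: by end_near. Qed.

Let good_next d eta A N : good d A -> 0 < eta ->
  exists2 m, (N <= m)%N & good (d - eta) (next A m).
Proof.
move=> gA eta0; near \oo => m; exists m; first by near: m; exact: nbhs_infty_ge.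
have [cA coneA _] := gA; split.
- have cs : {within A `*` `[0, 1], continuous (split m)}.
    exact/continuous_subspaceT/split_continuous.
  apply: (continuous_compact cs).
  by apply: compact_setX => //; exact: segment_compact.
- move=> y [[[c mu] s] [/= Ac]]; rewrite in_itv/= => /andP[s0 s1] <-.
  have [/= cc mu0] := coneA _ Ac.
  by split=> /=; [apply: coneD => //; exact: mulr_ge0|rewrite mulr_ge0// subr_ge0].
- move=> y [[[c mu] s] [/= Ac]]; rewrite in_itv/= => s01 <-.
  have hm : A `<=` [set a | forall s, 0 <= s <= 1 -> \forall n \near \oo,
      d - eta < q (a.1 + (s * a.2) *: v m + ((1 - s) * a.2) *: v n)].
    by near: m; exact: spread_near.
  exact: hm Ac _ s01.
Unshelve. all: by end_near. Qed.

(** A greedy choice: [A r] holds all ways of distributing mass 1 over the first [r] chosen terms and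
    a remainder kept for a later term, and [phi r] is picked to suit the whole compact set [A r] at
    once. Normalised coefficients leave no remainder after [r] steps. *)
Lemma convex_selection (delta eps : R) : cone 0 -> 0 < eps ->
  (\forall n \near \oo, delta < q (v n)) ->
  exists2 phi : nat -> nat, forall i, (i <= phi i)%N &
    forall r (lam : nat -> R), (forall i, 0 <= lam i) ->
      (delta - eps) * \sum_(0 <= i < r) lam i <=
      q (\sum_(0 <= i < r) lam i *: v (phi i)).
Proof.
move=> cone0 eps0 delta_lt.
(* Step [r] may lose [eps * 2^-1 ^+ r.+1]; all losses together stay below [eps]. *)
pose d r := delta - eps * (1 - 2^-1 ^+ r).
have dS r : d r.+1 = d r - eps * 2^-1 ^+ r.+1.
  by rewrite /d exprS; have := @divff R 2; rewrite pnatr_eq0 => /(_ isT); lra.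
have /choice[pick pickP] (p : nat * set (X * R)) : exists m, good (d p.1) p.2 ->
    (p.1 <= m)%N /\ good (d p.1.+1) (next p.2 m).
  have [gp|ngp] := pselect (good (d p.1) p.2); last by exists 0%N.
  have [|m pm gm] := @good_next _ (eps * 2^-1 ^+ p.1.+1) p.2 p.1 gp.
    by rewrite mulr_gt0// exprn_gt0// invr_gt0.
  by exists m => _; rewrite dS.
pose fix A r := if r is r'.+1 then next (A r') (pick (r', A r')) else [set (0, 1)].
pose phi r := pick (r, A r).
have goodA r : good (d r) (A r).
  elim: r => [|r ih]; last by have [] := pickP (r, A r) ih.
  split=> /=; first exact: compact_set1.
    by move=> _ ->; split.
  move=> _ ->; rewrite /d expr0 subrr mulr0 subr0.
  by apply: filterS delta_lt => n; rewrite add0r scale1r.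
exists phi; first by move=> i; have [] := pickP (i, A i) (goodA i).
move=> r lam lam0.
have memA mu : (forall i, 0 <= mu i) -> \sum_(0 <= i < r) mu i <= 1 ->
    A r (\sum_(0 <= i < r) mu i *: v (phi i), 1 - \sum_(0 <= i < r) mu i).
  move=> mu0; elim: (r) => [|k ih]; first by rewrite !big_geq// subr0.
  rewrite !big_nat_recr//= => le1; set S := \sum_(0 <= i < k) mu i in le1 ih *.
  have mk0 := mu0 k; have {}ih := ih (le_trans (ler_wpDr mk0 (lexx _)) le1).
  (* The fraction of the remaining mass [1 - S] to be spent is [mu k / (1 - S)]; with no mass left
     it is arbitrary and 0 is used. *)
  have [S1|S1] := eqVneq (1 - S) 0.
    have mk : mu k = 0 by lra.
    exists (\sum_(0 <= i < k) mu i *: v (phi i), 1 - S, 0) => /=.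
      by split=> //=; rewrite in_itv/= lexx ler01.
    by rewrite /split/= mk mul0r scale0r !addr0 S1 mulr0.
  exists (\sum_(0 <= i < k) mu i *: v (phi i), 1 - S, mu k / (1 - S)) => /=.
    split=> //=; rewrite in_itv/= ler_pdivrMr ?divr_ge0//=; lra.
  by rewrite /split/= divfK// mulrBl mul1r divfK// opprD addrA.
set L := \sum_(0 <= i < r) lam i.
have L0 : 0 <= L by exact: sumr_ge0.
have [L_eq0|Lneq0] := eqVneq L 0.
  by rewrite L_eq0 mulr0; exact: seminorm_ge0.
have Lpos : 0 < L by rewrite lt0r Lneq0.
have [_ _] := goodA r.
have := memA (fun i => L^-1 * lam i); rewrite -mulr_sumr mulVf// subrr lexx.
have -> : \sum_(0 <= i < r) (L^-1 * lam i) *: v (phi i) =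
    L^-1 *: \sum_(0 <= i < r) lam i *: v (phi i).
  by rewrite scaler_sumr; apply: eq_bigr => i _; rewrite scalerA.
move=> /(_ _ isT) memL /(_ _ (memL _))[].
  by move=> i; rewrite mulr_ge0// invr_ge0.
move=> N _ /(_ N (leqnn _)) /=; rewrite scale0r addr0 q_seminorm.2 gtr0_norm ?invr_gt0//.
rewrite ltr_pdivlMl// => /ltW; apply: le_trans; rewrite mulrC ler_wpM2l//.
have : 0 <= 2^-1 ^+ r :> R by rewrite exprn_ge0.
by rewrite /d; nra.
Qed.

End convex_selection.

(** * The Hardy operator *)

Section dilation.
Context (R : realType) (X : completeNormedModType R) (e : nat -> X) (K : R).
Hypothesis symK : K_symmetric K e.
Implicit Types (a b : nat -> R) (x y : X).

(** On finite combinations the series defining [dilation] is eventually constant, so its value is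
    known without any boundedness of the operator. *)
Lemma dilation_comb m a n : (0 < m)%N ->
  dilation e m (comb e a n) = comb e (fun j => a (j %/ m)%N) (n * m).
Proof.
move=> m0; rewrite /dilation (coords_comb symK); apply: lim_near_cst => //.
near=> k; have nk : (n <= k)%N by near: k; exact: nbhs_infty_ge.
rewrite /series /= (@big_cat_nat _ _ _ n)//= [X in _ + X](_ : _ = 0) ?addr0.
  transitivity (\sum_(0 <= i < n) a i *: \sum_(i * m <= j < i.+1 * m) e j).
    by apply: eq_big_nat => i /andP[_ i_n]; rewrite /cut i_n.
  elim: (n) => [|j ih]; first by rewrite /comb mul0n !big_geq.
  rewrite big_nat_recr//= ih /comb [RHS](@big_cat_nat _ _ _ (j * m))//=.
    congr (_ + _); rewrite scaler_sumr; apply: eq_big_nat => i /andP[ji ij].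
    congr (a _ *: _); apply/eqP.
    by rewrite eqn_leq leq_divRL// ji -ltnS ltn_divLR.
  by rewrite leq_mul2r leqnSn orbT.
rewrite big_nat_cond; apply: big1 => i; rewrite andbT => /andP[ni _].
by rewrite /cut ltnNge ni scale0r.
Unshelve. all: by end_near. Qed.

(** Some [m] has quotient greater than 1. If [r = ||D_m||] were at least [m], then
    [ln r >= ln m > 0] and the quotient would be at most 1; an infinite operator norm would make it
    0. Arguing by contradiction avoids the quotients with [r <= 1]. *)
Lemma dilation_bound : (1 < lower_boyd e)%E -> exists2 m, (1 < m)%N &
  exists2 rho : R, 0 <= rho < m%:R & forall a n,
    `|comb e (fun j => a (j %/ m)%N) (n * m)| <= rho * `|comb e a n|.
Proof.
move=> /ereal_sup_gt[_ [m /= m2 <-]] lt1.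
have m0 : (0 < m)%N by exact: ltnW.
have op_ge x : `|x| <= 1 -> (`|dilation e m x|%:E <= opnorm (dilation e m))%E.
  by move=> x1; apply: ereal_sup_ubound; exists x.
have op0 : (0 <= opnorm (dilation e m))%E.
  by apply: le_trans (op_ge 0 _); rewrite ?normr0// lee_fin.
have lnm : 0 < ln (m%:R : R) by rewrite ln_gt0// ltr1n.
have [r r0 opr] : exists2 r : R, 0 <= r < m%:R & opnorm (dilation e m) = r%:E.
  move: lt1 op0; case: (opnorm _) => [r| |]; last by [].
    rewrite lee_fin => lt1 r0; exists r => //; rewrite r0/= ltNge; apply/negP => mr.
    have r_gt0 : 0 < r by apply: lt_le_trans mr; rewrite ltr0n.
    move: lt1; rewrite lne_EFin//.
    have lnr : 0 < ln r by apply: (lt_le_trans lnm); rewrite ler_ln// posrE ltr0n.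
    rewrite inver gt_eqF// -EFinM lte_fin ltr_pdivlMr// mul1r ltNge ler_ln ?posrE ?ltr0n//.
    by rewrite mr.
  by rewrite /= invey mule0 ltNge lee_fin ler01.
exists m => //; exists r => // a n; rewrite -dilation_comb//.
set x := comb e a n; have [x0|x0] := eqVneq x 0.
  rewrite x0 normr0 mulr0 -(_ : comb e a 0 = 0); last by rewrite /comb big_geq.
  by rewrite dilation_comb// mul0n /comb big_geq// normr0.
have nx : 0 < `|x| by rewrite normr_gt0.
have := op_ge (`|x|^-1 *: x); rewrite normrZ normfV normr_id mulVf ?gt_eqF//.
move=> /(_ (lexx _)); rewrite opr lee_fin.
have scE c (b : nat -> R) k : c *: comb e b k = comb e (fun i => c * b i) k.
  by rewrite /comb scaler_sumr; apply: eq_bigr => i _; rewrite scalerA.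
rewrite /x scE dilation_comb// -scE -dilation_comb// normrZ normfV normr_id.
by rewrite ler_pdivrMl// mulrC.
Qed.

Lemma dilation_iter_bound m (rho : R) l a n : (0 < m)%N -> 0 <= rho ->
  (forall a n, `|comb e (fun j => a (j %/ m)%N) (n * m)| <= rho * `|comb e a n|) ->
  `|comb e (fun j => a (j %/ m ^ l)%N) (n * m ^ l)| <= rho ^+ l * `|comb e a n|.
Proof.
move=> m0 rho0 hrho; elim: l => [|l ih].
  rewrite expn0 muln1 expr0 mul1r (comb_eq _ (b := a))// => i _.
  by rewrite divn1.
rewrite exprS -mulrA; apply: le_trans (ler_wpM2l rho0 ih).
apply: le_trans (hrho _ _); rewrite -mulnA -expnSr.
by rewrite (comb_eq _ (b := fun j => a ((j %/ m) %/ m ^ l)%N))// => i _; rewrite -divnMA -expnS.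
Qed.

End dilation.

Section hardy.
Context (R : realType) (X : completeNormedModType R) (e : nat -> X) (K : R).
Hypothesis symK : K_symmetric K e.
Context (m : nat) (rho : R).
Hypothesis m_gt1 : (1 < m)%N.
Hypothesis rho_lt : 0 <= rho < m%:R.
Hypothesis dil : forall a n,
  `|comb e (fun j => a (j %/ m)%N) (n * m)| <= rho * `|comb e a n|.
Implicit Types (a b : nat -> R) (x y : X).

Local Notation co := (coords e).

Let K_ge1 : 1 <= K. Proof. by case: symK. Qed.
Let K_ge0 : 0 <= K. Proof. exact: le_trans ler01 K_ge1. Qed.
Let m_gt0 : (0 < m)%N. Proof. exact: ltnW. Qed.

Definition top_norm j x := top_sum (fun i => `|co x i|) j.

(** [trunc_log m i] is the [k] with [m ^ k <= i < m ^ k.+1]; it is 0 at [i = 0], so index 0 joins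
    the block of [k = 0]. Averaging only at powers of [m] lets iterates of the single dilation by
    [m] dominate the result. *)
Definition hardy_coord x i : R :=
  top_norm (m ^ trunc_log m i) x / (m ^ trunc_log m i)%:R.

Let cB := coord_le symK.

Lemma top_norm_ge0 j x : 0 <= top_norm j x.
Proof. exact: (top_sum_ge0 (M := coord_bound e K * `|x|)). Qed.

Lemma top_norm_le j x : top_norm j x <= j%:R * (coord_bound e K * `|x|).
Proof. exact: top_sum_le_card. Qed.

Lemma top_norm_ge j x (A : {fset nat}) : (#|` A| <= j)%N ->
  \sum_(i <- A) `|co x i| <= top_norm j x.
Proof. exact: (top_sum_ge (M := coord_bound e K * `|x|)). Qed.

Lemma top_norm_mono j x y : (forall i, `|co x i| <= `|co y i|) ->
  top_norm j x <= top_norm j y.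
Proof. by move=> xy; apply: (top_sumS _ (M := coord_bound e K * `|y|)). Qed.

Lemma top_norm_seminorm j : seminorm (top_norm j).
Proof.
apply: seminorm_of_le => [x|x y|t x]; first exact: top_norm_ge0.
  apply: top_sum_le => // A Aj.
  apply: le_trans (lerD (top_norm_ge x Aj) (top_norm_ge y Aj)).
  rewrite -big_split/=; apply: ler_sum => i _; rewrite (coordsD symK); exact: ler_normD.
apply: top_sum_le => // A Aj; apply: le_trans (ler_wpM2l (normr_ge0 _) (top_norm_ge x Aj)).
by rewrite mulr_sumr; apply: ler_sum => i _; rewrite (coordsZ symK) normrM.
Qed.

Let mk_gt0 k : 0 < (m ^ k)%:R :> R.
Proof. by rewrite ltr0n expn_gt0 m_gt0. Qed.

Lemma hardy_coord_ge0 x i : 0 <= hardy_coord x i.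
Proof. by rewrite /hardy_coord divr_ge0// ?top_norm_ge0. Qed.

Lemma hardy_coordD x y i : hardy_coord (x + y) i <= hardy_coord x i + hardy_coord y i.
Proof.
by rewrite /hardy_coord -mulrDl ler_wpM2r ?invr_ge0//; exact: (top_norm_seminorm _).1.
Qed.

Lemma hardy_coordZ t x i : hardy_coord (t *: x) i = `|t| * hardy_coord x i.
Proof. by rewrite /hardy_coord (top_norm_seminorm _).2 mulrA. Qed.

Lemma hardy_coord_mono x y i : (forall i, `|co x i| <= `|co y i|) ->
  hardy_coord x i <= hardy_coord y i.
Proof. by move=> xy; rewrite ler_wpM2r ?invr_ge0//; exact: top_norm_mono. Qed.

Lemma hardy_coord_le x i : hardy_coord x i <= coord_bound e K * `|x|.
Proof. by rewrite ler_pdivrMr// mulrC; exact: top_norm_le. Qed.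

Let coords_sum n (F : nat -> X) i :
  co (\sum_(0 <= l < n) F l) i = \sum_(0 <= l < n) co (F l) i.
Proof.
elim: n => [|n ih]; first by rewrite !big_geq// (coords0 symK).
by rewrite !big_nat_recr//= (coordsD symK) ih.
Qed.

Lemma nonincreasing_rearrangement a n : exists sigma : nat -> nat, exists b,
  [/\ bijective sigma, (forall i, b i = `|co (comb e a n) (sigma i)|),
      {homo b : i k / (i <= k)%N >-> k <= i}, (forall i, (n <= i)%N -> b i = 0) &
      `|comb e b n| <= K * `|comb e a n| /\ `|comb e a n| <= K * `|comb e b n|].
Proof.
set x := comb e a n.
have xn i : (n <= i)%N -> `|co x i| = 0.
  by move=> ni; rewrite /x (coords_comb symK) /cut ltnNge ni normr0.
have [sigma bs [bm sn]] := sort_nonincreasing (fun i => normr_ge0 (co x i)) xn.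
have [y yE] := exists_rearranged symK x bs.
have yn : y = comb e (fun i => `|co x (sigma i)|) n.
  apply: (coords_inj symK); rewrite (coords_comb symK); apply/funext => i.
  by rewrite yE /cut; case: ltnP => // ni; rewrite sn// xn.
exists sigma, (fun i => `|co x (sigma i)|); split=> //.
  by move=> i ni; rewrite sn// xn.
rewrite -yn; split.
  by apply: (norm_rearranged_le symK bs) => i; rewrite yE normr_id.
have [tau st ts] := bs.
by apply: (norm_rearranged_le symK (Bijective ts st)) => i; rewrite yE ts normr_id.
Qed.

(** One [K] comes from domination by a series of dilations, the other from sorting the coordinates.
    The 2 is that of [top_sum_nonincreasing], and the rest is the sum over [l] of
    [rho ^+ l.+2 / m%:R ^+ l]. *)
Definition hardy_const : R := K * (2 * rho ^+ 2 / (1 - rho / m%:R)) * K.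

Let ratio_lt1 : 0 <= rho / m%:R < 1.
Proof.
have [r0 rm] := andP rho_lt; rewrite divr_ge0//= ltr_pdivrMr ?mul1r//.
by rewrite ltr0n.
Qed.

Lemma hardy_const_ge0 : 0 <= hardy_const.
Proof.
have [r0 r1] := andP ratio_lt1; have [rho0 _] := andP rho_lt.
by rewrite /hardy_const !mulr_ge0// ?invr_ge0 ?exprn_ge0// subr_ge0 ltW.
Qed.

Lemma hardy_finite a n J :
  `|comb e (hardy_coord (comb e a n)) J| <= hardy_const * `|comb e a n|.
Proof.
have [sigma [b [bs bE bm bn [bK _]]]] := nonincreasing_rearrangement a n.
have b0 i : 0 <= b i by rewrite bE.
set x := comb e a n in bE bK *.
have topb j : top_norm j x <= 2 * \sum_(0 <= i < j) b i.
  rewrite /top_norm -(top_sum_bij _ _ bs); apply: le_trans (top_sum_nonincreasing _ b0 bm).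
  by rewrite le_eqVlt; apply/orP; left; apply/eqP; congr top_sum; apply/funext => i /=; rewrite bE.
(* By [power_average_le] this combination of iterated dilations of the sorted sequence dominates the
   first [J] Hardy coordinates. *)
pose z : X := \sum_(0 <= l < J) (2 * m%:R^-1 ^+ l) *:
  comb e (fun j => b (j %/ m ^ l.+2)%N) (n * m ^ l.+2).
have zE i : co z i = \sum_(0 <= l < J) (2 * m%:R^-1 ^+ l) * b (i %/ m ^ l.+2)%N.
  rewrite coords_sum; apply: eq_bigr => l _.
  rewrite (coordsZ symK) (coords_comb symK) /cut; case: ltnP => // h.
  by rewrite bn// leq_divRL// expn_gt0 m_gt0.
have xz : `|comb e (hardy_coord x) J| <= K * `|z|.
  apply: (dominated_norm symK) => i; rewrite (coords_comb symK) /cut.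
  case: ltnP => iJ; last by rewrite normr0.
  rewrite ger0_norm ?hardy_coord_ge0// (le_trans _ (ler_norm _))// zE.
  (* Coordinate [i] uses only the terms [l <= trunc_log m i], all of which occur in [z] because
     [i < J]. *)
  have lJ : ((trunc_log m i).+1 <= J)%N.
    have [->|i0] := posnP i; first by rewrite trunc_log0 (leq_ltn_trans _ iJ).
    apply: leq_ltn_trans iJ; apply: leq_trans (trunc_logP m_gt1 i0).
    by apply: ltnW; exact: ltn_expl.
  apply: (@le_trans _ _ (2 * power_average b m (trunc_log m i))).
    by rewrite /hardy_coord /power_average mulrA ler_wpM2r ?invr_ge0.
  apply: (@le_trans _ _ (2 * \sum_(0 <= l < (trunc_log m i).+1) m%:R^-1 ^+ l * b (i %/ m ^ l.+2)%N)).
    by rewrite ler_wpM2l//; apply: power_average_le => //; exact: trunc_log_ltn.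
  rewrite mulr_sumr [leRHS](@big_cat_nat _ _ _ _ 0 _ _ _ (leq0n _) lJ)/=.
  rewrite -[leLHS]addr0; apply: lerD; last first.
    by apply: sumr_ge0 => l _; rewrite !mulr_ge0// exprn_ge0// invr_ge0.
  by apply: ler_sum => l _; rewrite mulrA.
apply: (le_trans xz); rewrite /hardy_const.
set D := 2 * rho ^+ 2 / (1 - rho / m%:R).
suff zD : `|z| <= D * (K * `|x|).
  by rewrite -mulrA -mulrA; apply: ler_wpM2l.
have [rho0 _] := andP rho_lt; have [t0 t1] := andP ratio_lt1.
have zn : `|z| <= \sum_(0 <= l < J) 2 * rho ^+ 2 * (rho / m%:R) ^+ l * `|comb e b n|.
  apply: (le_trans (ler_norm_sum _ _ _)); apply: ler_sum => l _.
  rewrite normrZ ger0_norm ?mulr_ge0 ?exprn_ge0 ?invr_ge0//.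
  apply: (le_trans (ler_wpM2l _ (dilation_iter_bound l.+2 b n m_gt0 rho0 dil))).
    by rewrite mulr_ge0// exprn_ge0// invr_ge0.
  by rewrite -(addn2 l) exprD exprMn le_eqVlt; apply/orP; left; apply/eqP; ring.
apply: (le_trans zn); rewrite -mulr_suml -mulr_sumr.
have geo : \sum_(0 <= l < J) (rho / m%:R) ^+ l <= (1 - rho / m%:R)^-1.
  rewrite -[leRHS]mul1r ler_pdivlMr ?subr_gt0// mulrC.
  have -> : (1 - rho / m%:R) * \sum_(0 <= l < J) (rho / m%:R) ^+ l = 1 - (rho / m%:R) ^+ J.
    elim: J {z zE xz zn} => [|J ih]; first by rewrite big_geq// mulr0 expr0 subrr.
    by rewrite big_nat_recr//= mulrDr ih exprS; ring.
  by rewrite lerBlDr lerDl exprn_ge0.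
apply: ler_pM => //; first by rewrite !mulr_ge0 ?exprn_ge0// sumr_ge0// => l _; rewrite exprn_ge0.
by rewrite /D ler_wpM2l// mulr_ge0// exprn_ge0.
Qed.

End hardy.

(** * The Hardy operator on the whole space and its lower estimate *)

Section hardy_operator.
Context (R : realType) (X : completeNormedModType R) (e : nat -> X) (K : R).
Hypothesis symK : K_symmetric K e.
Hypothesis refl_X : reflexive_space X.
Context (m : nat) (rho : R).
Hypothesis m_gt1 : (1 < m)%N.
Hypothesis rho_lt : 0 <= rho < m%:R.
Hypothesis dil : forall a n,
  `|comb e (fun j => a (j %/ m)%N) (n * m)| <= rho * `|comb e a n|.
Implicit Types (a b : nat -> R) (x y : X).

Local Notation co := (coords e).
Local Notation hardy_coord := (hardy_coord e m).

Let K_ge1 : 1 <= K. Proof. by case: symK. Qed.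
Let K_ge0 : 0 <= K. Proof. exact: le_trans ler01 K_ge1. Qed.
Let m_gt0 : (0 < m)%N. Proof. exact: ltnW. Qed.

Lemma weak_limit_coords (w : nat -> X) x i (alpha : R) :
  (forall f : X -> R^o, dual_space f -> forall c : R,
     (\forall n \near \oo, c <= f (w n)) -> c <= f x) ->
  (fun n => co (w n) i) @ \oo --> alpha -> co x i = alpha.
Proof.
move=> wx wa; apply/eqP; rewrite eq_le; apply/andP; split.
  apply/ler_addgt0Pr => eps eps0; rewrite -[leLHS]opprK lerNl.
  have [lin cont] := coords_dual symK i.
  have dN : dual_space (fun y => - co y i : R^o).
    split=> [t y z|]; first by rewrite lin opprD scalerN.
    by move=> y; apply: cvgN; exact: cont.
  apply: (wx _ dN); near=> n; rewrite lerN2; near: n.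
  by apply: (cvgr_le _ wa); rewrite ltrDl.
apply/ler_addgt0Pr => eps eps0; rewrite -lerBlDr.
apply: (wx _ (coords_dual symK i)); apply: (cvgr_ge _ wa).
by rewrite ltrBlDr ltrDl.
Unshelve. all: by end_near. Qed.

Definition hardy_bound : R := K * (hardy_const K m rho * K).

(** A finite section of [x] is covered by [hardy_finite]. The rest enters through [J] coordinates
    only, each bounded by a multiple of the norm of [tail e n x], so for fixed [J] it disappears as
    [n] grows. *)
Lemma hardy_comb_le x J : `|comb e (hardy_coord x) J| <= hardy_bound * `|x|.
Proof.
pose E := K * \sum_(0 <= i < J) coord_bound e K * `|e i|.
have cB0 := coord_bound_gt0 symK.
have E0 : 0 <= E by rewrite mulr_ge0// sumr_ge0// => i _; rewrite mulr_ge0// ltW.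
have approx n : `|comb e (hardy_coord x) J| <= hardy_bound * `|x| + E * `|tail e n x|.
  pose xn := comb e (co x) n.
  have xE : x = xn + tail e n x by rewrite /tail addrC subrK.
  apply: (@le_trans _ _ (K * `|comb e (fun i => hardy_coord xn i + hardy_coord (tail e n x) i) J|)).
    apply: (norm_comb_le symK) => i _; rewrite !ger0_norm ?addr_ge0 ?(hardy_coord_ge0 symK)//.
    by rewrite {1}xE (hardy_coordD symK).
  rewrite /hardy_bound /E -[X in _ <= X + _]mulrA -[X in _ <= _ + X]mulrA -mulrDr.
  rewrite ler_wpM2l//.
  rewrite /comb; under eq_bigr => i _ do rewrite scalerDl.
  rewrite big_split/=; apply: (le_trans (ler_normD _ _)); apply: lerD.
    apply: (le_trans (hardy_finite symK m_gt1 rho_lt dil _ _ _)).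
    rewrite -mulrA ler_wpM2l ?(hardy_const_ge0 symK m_gt1 rho_lt)//.
    apply: (dominated_norm symK) => i; rewrite (coords_comb symK) /cut.
    by case: ifP; rewrite ?normr0.
  apply: (le_trans (ler_norm_sum _ _ _)); rewrite mulr_suml; apply: ler_sum => i _.
  rewrite normrZ ger0_norm ?(hardy_coord_ge0 symK)// [leRHS]mulrAC ler_wpM2r//.
  exact: hardy_coord_le.
have tn : (fun n => hardy_bound * `|x| + E * `|tail e n x|) @ \oo --> hardy_bound * `|x| + E * `|0 : X|.
  apply: cvgD; first exact: cvg_cst.
  by apply: cvgM; [exact: cvg_cst|apply: cvg_norm; apply: (tail_cvg symK)].
rewrite normr0 mulr0 addr0 in tn.
by apply: (cvgr_to_ge tn); exact: nearW.
Qed.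

(** The partial sums are bounded, and reflexivity turns this into a vector: their weak limit has the
    required coordinates. *)
Lemma hardy_exists x : exists y, forall i, co y i = hardy_coord x i.
Proof.
have [y yP] := reflexive_weak_limit refl_X (hardy_comb_le x).
exists y => i; apply: (weak_limit_coords yP).
apply: cvg_near_cst; near=> n; rewrite (coords_comb symK) /cut.
suff -> : (i < n)%N by [].
by near: n; exact: nbhs_infty_gt.
Unshelve. all: by end_near. Qed.

Definition hardy x : X := xget 0 [set y | forall i, co y i = hardy_coord x i].

Lemma coords_hardy x i : co (hardy x) i = hardy_coord x i.
Proof.
have [y yE] := hardy_exists x.
have /(_ i) := @xgetPex _ 0 [set y | forall i, co y i = hardy_coord x i] (ex_intro _ y yE).
by [].
Qed.

Lemma hardy_le x : `|hardy x| <= hardy_bound * `|x|.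
Proof.
have := coords_expands symK (hardy x).
rewrite (_ : co (hardy x) = hardy_coord x); last by apply/funext => i; exact: coords_hardy.
move=> /cvg_norm hx; apply: (cvgr_to_le hx); apply: nearW => n; exact: hardy_comb_le.
Qed.

Lemma hardyZ t x : hardy (t *: x) = `|t| *: hardy x.
Proof.
apply: (coords_inj symK); apply/funext => i.
by rewrite (coordsZ symK) !coords_hardy (hardy_coordZ symK).
Qed.

Lemma hardy_bij x y (sigma : nat -> nat) : bijective sigma ->
  (forall i, `|co y i| = `|co x (sigma i)|) -> hardy y = hardy x.
Proof.
move=> bs yx; apply: (coords_inj symK); apply/funext => i.
rewrite !coords_hardy /hardy_coord /top_norm; congr (_ / _).
rewrite -[RHS](top_sum_bij _ _ bs); congr top_sum.
by apply/funext => k /=; rewrite yx.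
Qed.

(** A term of a decreasing sequence is at most the mean of the terms before it, so the sorted moduli
    lie below the Hardy coordinates. The first [k] of them are bounded by [theta], the others by the
    tail. Thus small coordinates and a small Hardy tail force a small norm. *)
Lemma norm_le_hardy_tail x k theta : (forall i, `|co x i| <= theta) ->
  `|x| <= K * (theta * \sum_(0 <= i < k) `|e i| + K * `|tail e k (hardy x)|).
Proof.
move=> xtheta; set M := _ * (_ + _).
(* A vector with infinite support and a zero coordinate cannot be sorted by a bijection, so the
   estimate is made for finite sections and passed to the limit. *)
have := coords_expands symK x; move=> /cvg_norm hx.
apply: (cvgr_to_le hx); apply: nearW => N.
rewrite -/(comb e (co x) N); set xN := comb e (co x) N.
have [sigma [b [bs bE bm bN [_ xb]]]] := nonincreasing_rearrangement symK (co x) N.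
apply: (le_trans xb); rewrite -/xN /M ler_wpM2l//.
have b0 i : 0 <= b i by rewrite bE.
have xNx i : `|co xN i| <= `|co x i|.
  by rewrite /xN (coords_comb symK) /cut; case: ifP; rewrite ?normr0.
have bh i : b i <= hardy_coord x i.
  apply: (@le_trans _ _ (hardy_coord xN i)); last first.
    exact: (hardy_coord_mono symK).
  rewrite /hardy_coord; set p := (m ^ _)%N.
  have p0 : (0 < p)%N by rewrite expn_gt0 m_gt0.
  rewrite ler_pdivlMr ?ltr0n//.
  apply: (@le_trans _ _ (\sum_(0 <= l < p) b l)).
    rewrite mulr_natr -[X in _ *+ X]subn0 -sumr_const_nat.
    apply: ler_sum_nat => l /andP[_ lp]; apply: bm.
    have [i0|i0] := posnP i; last exact: ltnW (leq_trans lp (trunc_logP m_gt1 i0)).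
    by move: lp; rewrite /p i0 trunc_log0 expn0 ltnS.
  rewrite /top_norm -(top_sum_bij _ _ bs).
  have -> : (fun i => `|co xN i|) \o sigma = b by apply/funext => l /=; rewrite bE.
  apply: (top_sum_ge_prefix (M := theta)) => // l; rewrite bE.
  exact: le_trans (xtheta _).
have coz i : co (comb e b N) i = b i.
  by rewrite (coords_comb symK) /cut; case: ltnP => // Ni; rewrite bN.
rewrite -(subrK (comb e b k) (comb e b N)) addrC.
apply: (le_trans (ler_normD _ _)); apply: lerD.
  rewrite mulr_sumr; apply: (le_trans (ler_norm_sum _ _ _)); apply: ler_sum => i _.
  by rewrite normrZ ler_wpM2r// ger0_norm// bE (le_trans _ (xtheta (sigma i))).
apply: (dominated_norm symK) => i.
rewrite (coordsB symK) coz (coords_comb symK) /cut (coords_tail symK).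
case: ifP => _; first by rewrite subrr.
by rewrite subr0 coords_hardy ger0_norm// (le_trans (bh i))// ler_norm.
Qed.

Lemma norm_le_hardy x : `|x| <= K * K * `|hardy x|.
Proof.
have := @norm_le_hardy_tail x 0 (coord_bound e K * `|x|) (coord_le symK x).
by rewrite big_geq// mulr0 add0r (tail0 e) mulrA.
Qed.

End hardy_operator.

(* Unification would otherwise unfold [xget] when a rewrite rule fails to match. *)
Global Opaque hardy.

(** * The family of seminorms *)

Lemma cauchy_seq_cvg (R : realType) (X : completeNormedModType R) (u : nat -> X) :
  (forall eps : R, 0 < eps -> exists M, forall n, (M <= n)%N -> `|u M - u n| <= eps) ->
  cvgn u.
Proof.
move=> h; apply/cauchy_cvgP/cauchy_exP => eps eps0.
have [M hM] := h _ (divr_gt0 eps0 (ltr0n R 2)); exists (u M).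
exists M => // n /= Mn; rewrite -ball_normE /=.
by apply: (le_lt_trans (hM _ Mn)); rewrite ltr_pdivrMr// ltr_pMr// ltr1n.
Qed.

Definition almost_constant (R : realType) (X : lmodType R) (p : X -> R)
    (u : nat -> X) (l : R) : Prop :=
  forall eps, 0 < eps -> exists M, forall m n, (M <= m)%N -> (M <= n)%N ->
    `|p (u n) - l| <= eps /\ `|p (u m + u n) - 2 * l| <= eps.

(** The parallelogram defect of the sum tends to 0, hence so does that of [p t]. It dominates the
    square of [p t (u m) - p t (u n)], which makes the values Cauchy, and its smallness also makes
    [p t (u m + u n)] nearly additive. *)
Lemma l2_sum_almost_constant (R : realType) (X : normedModType R) (T : countType)
    (p : T -> X -> R) (p_seminorm : forall t, seminorm (p t))
    (p_bounded : forall t, exists C : R, forall x, p t x <= C * `|x|) (u : nat -> X) :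
  (forall n, l2_sum p_bounded (u n) <= 1) ->
  (forall eps, 0 < eps -> exists M, forall m n, (M <= m)%N -> (M <= n)%N ->
     2 - eps <= l2_sum p_bounded (u m + u n)) ->
  forall t, exists l, almost_constant (p t) u l.
Proof.
move=> u1 u2 t; have [c c0 para] := l2_sum_parallelogram p_seminorm p_bounded t.
have N0 x := seminorm_ge0 x (l2_sum_seminorm p_seminorm p_bounded).
have p0 x := seminorm_ge0 x (p_seminorm t).
have small eta : 0 < eta -> exists M, forall m n, (M <= m)%N -> (M <= n)%N ->
    2 * p t (u m) ^+ 2 + 2 * p t (u n) ^+ 2 - p t (u m + u n) ^+ 2 <= eta.
  (* A sum of norm at least [2 - c * eta / 4] has square at least [4 - c * eta], so the total defect
     is at most [c * eta]. *)
  move=> eta0; have ce : 0 < c * eta / 4 by rewrite divr_gt0// mulr_gt0.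
  have [M hM] := u2 _ ce; exists M => m n Mm Mn.
  rewrite -(ler_pM2l c0); apply: (le_trans (para _ _)).
  have := hM m n Mm Mn; have := u1 m; have := u1 n.
  have := N0 (u m); have := N0 (u n); have := N0 (u m + u n).
  move: (l2_sum _ (u m)) (l2_sum _ (u n)) (l2_sum _ (u m + u n)) => a b s s0 b0 a0 b1 a1 hs.
  have a2 : a ^+ 2 <= 1 by rewrite expr_le1.
  have b2 : b ^+ 2 <= 1 by rewrite expr_le1.
  have s2 : 4 - c * eta <= s ^+ 2.
    have [h|h] := leP 4 (c * eta); first by have := sqr_ge0 s; lra.
    have : (2 - c * eta / 4) ^+ 2 <= s ^+ 2.
      by rewrite lerXn2r ?nnegrE//; lra.
    by have := sqr_ge0 (c * eta / 4); lra.
  by lra.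
have diff m n : (p t (u m) - p t (u n)) ^+ 2 <=
    2 * p t (u m) ^+ 2 + 2 * p t (u n) ^+ 2 - p t (u m + u n) ^+ 2.
  have := (p_seminorm t).1 (u m) (u n); have := p0 (u m + u n).
  by have := p0 (u m); have := p0 (u n); nra.
have cv : cvgn (fun n => p t (u n) : R^o).
  apply: cauchy_seq_cvg => eps eps0; have [M hM] := small _ (exprn_gt0 2 eps0).
  exists M => n Mn; apply: sqr_le_le; first exact: ltW.
  by rewrite real_normK ?num_real//; apply: (le_trans (diff _ _)); exact: hM.
pose l : R := limn (fun n => p t (u n) : R^o).
have cvl : (fun n => p t (u n)) @ \oo --> l by [].
exists l => eps eps0.
have e4 : 0 < eps / 4 by rewrite divr_gt0.
have [M1 hM1] := small _ (exprn_gt0 2 e4).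
have [M2 _ hM2] : \forall n \near \oo, `|l - p t (u n)| <= eps / 4.
  by move/cvgrPdist_le : cvl; apply.
exists (maxn M1 M2) => m n; rewrite !geq_max => /andP[m1 m2] /andP[n1 n2].
have := hM1 m n m1 n1; have /= := hM2 m m2; have /= := hM2 n n2.
have := (p_seminorm t).1 (u m) (u n); have := p0 (u m + u n).
have := p0 (u m); have := p0 (u n).
move: (p t (u m)) (p t (u n)) (p t (u m + u n)) => a b s b0 a0 s0 sab.
rewrite !ler_norml => /andP[lb1 lb2] /andP[la1 la2] hs.
have : a + b <= s + eps / 4.
  apply: sqr_le_le; first by lra.
  by have := sqr_ge0 (a - b); have := mulr_ge0 s0 (ltW e4); lra.
by move=> hab; split; rewrite ?ler_norml; apply/andP; split; lra.
Qed.

Section family.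
Context (R : realType) (X : completeNormedModType R) (e : nat -> X) (K : R).
Hypothesis symK : K_symmetric K e.
Hypothesis refl_X : reflexive_space X.
Context (m : nat) (rho : R).
Hypothesis m_gt1 : (1 < m)%N.
Hypothesis rho_lt : 0 <= rho < m%:R.
Hypothesis dil : forall a n,
  `|comb e (fun j => a (j %/ m)%N) (n * m)| <= rho * `|comb e a n|.
Implicit Types (a b : nat -> R) (x y : X).

Local Notation co := (coords e).
Local Notation hardy := (hardy e m).
Local Notation lat := (lattice_norm e).

Let K_ge1 : 1 <= K. Proof. by case: symK. Qed.
Let K_ge0 : 0 <= K. Proof. exact: le_trans ler01 K_ge1. Qed.
Let coH := coords_hardy symK refl_X m_gt1 rho_lt dil.
Let slat := lattice_norm_seminorm symK.

(* The Euclidean counterpart of [top_norm]: the parallelogram identity turns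
   almost equality in its triangle inequality into closeness of coordinates. *)
Definition top_l2 j x : R := Num.sqrt (top_sum (fun i => co x i ^+ 2) j).

Let sq_le x i : co x i ^+ 2 <= (coord_bound e K * `|x|) ^+ 2.
Proof.
rewrite -(real_normK (num_real (co x i))) lerXn2r ?nnegrE//; last exact: coord_le.
by rewrite mulr_ge0// ltW// (coord_bound_gt0 symK).
Qed.

Let sq_ge0 x i : 0 <= co x i ^+ 2. Proof. exact: sqr_ge0. Qed.

Lemma top_l2_sqr j x : top_l2 j x ^+ 2 = top_sum (fun i => co x i ^+ 2) j.
Proof. by rewrite sqr_sqrtr// (top_sum_ge0 (sq_ge0 x) (sq_le x)). Qed.

Lemma top_l2_ge j x (A : {fset nat}) : (#|` A| <= j)%N ->
  \sum_(i <- A) co x i ^+ 2 <= top_l2 j x ^+ 2.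
Proof. by rewrite top_l2_sqr; exact: (top_sum_ge (sq_ge0 x) (sq_le x)). Qed.

Lemma top_l2_seminorm j : seminorm (top_l2 j).
Proof.
have t0 x : 0 <= top_l2 j x by exact: sqrtr_ge0.
apply: seminorm_of_le => // [x y|t x]; (apply: sqr_le_le; first by rewrite ?addr_ge0 ?mulr_ge0);
  rewrite top_l2_sqr; apply: top_sum_le => // A Aj.
  rewrite -(sqr_sqrtr (sumr_ge0 _ (fun i _ => sq_ge0 (x + y) i))).
  rewrite lerXn2r ?nnegrE ?sqrtr_ge0 ?addr_ge0//.
  under eq_bigr => i _ do rewrite (coordsD symK).
  apply: le_trans (l2_triangle _ _ _) _; apply: lerD.
    by apply: ler_wsqrtr; rewrite -top_l2_sqr top_l2_ge.
  by apply: ler_wsqrtr; rewrite -top_l2_sqr top_l2_ge.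
under eq_bigr => i _ do rewrite (coordsZ symK) exprMn.
by rewrite -mulr_sumr exprMn real_normK ?num_real// ler_wpM2l ?sqr_ge0// top_l2_ge.
Qed.

Definition hardy_norm x : R := lat (hardy x).

Lemma hardy_norm_seminorm : seminorm hardy_norm.
Proof.
split=> [x y|t x]; last first.
  rewrite /hardy_norm (hardyZ symK refl_X m_gt1 rho_lt dil).
  by rewrite slat.2 normr_id.
apply: le_trans (slat.1 _ _); apply: (lattice_norm_mono symK) => i.
rewrite (coordsD symK) !coH !ger0_norm ?addr_ge0 ?(hardy_coord_ge0 symK)//.
exact: (hardy_coordD symK).
Qed.

Lemma hardy_norm_le : exists2 C : R, 0 <= C & forall x, hardy_norm x <= C * `|x|.
Proof.
exists (K * `|hardy_bound K m rho|); first by rewrite mulr_ge0.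
move=> x; apply: (le_trans (lattice_norm_le symK _)); rewrite -mulrA ler_wpM2l//.
apply: (le_trans (hardy_le symK refl_X m_gt1 rho_lt dil x)).
by rewrite ler_wpM2r// ler_norm.
Qed.

Lemma norm_le_hardy_norm x : `|x| <= K * K * hardy_norm x.
Proof.
apply: (le_trans (norm_le_hardy symK refl_X m_gt1 rho_lt dil x)).
by rewrite ler_wpM2l ?mulr_ge0// (norm_le_lattice symK).
Qed.

(** Nonnegative rational coordinates with the common denominator [sd.2.+1]; this coding keeps the
    index type of the seminorms countable. *)
Definition grid_vector (sd : seq nat * nat) : X :=
  comb e (fun i => (nth 0%N sd.1 i)%:R / sd.2.+1%:R) (size sd.1).

(* Adding [hardy_norm x *: c] keeps the functional homogeneous while giving
   access to the translates [x |-> q (x + c)] of the seminorms [q] of tails. *)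
Definition tail_norm k c x : R := lat (tail e k (hardy x + hardy_norm x *: c)).

Lemma tail_lattice_seminorm k : seminorm (fun x => lat (tail e k x)).
Proof.
split=> [x y|t x]; first by rewrite (tailD symK); exact: slat.1.
by rewrite (tailZ symK); exact: slat.2.
Qed.

(** Separated from the triangle inequality because [hardy_spread] needs this stronger form: the
    right-hand side is still the norm of a sum of Hardy transforms. *)
Lemma tail_normD k c x y : (forall i, 0 <= co c i) ->
  tail_norm k c (x + y) <=
  lat (tail e k ((hardy x + hardy_norm x *: c) + (hardy y + hardy_norm y *: c))).
Proof.
move=> c0; have N0 z := seminorm_ge0 z hardy_norm_seminorm.
apply: (lattice_norm_mono symK) => i; rewrite !(coords_tail symK).
case: ifP => _; first by rewrite normr0.
have E z : co (hardy z + hardy_norm z *: c) i = hardy_coord e m z i + hardy_norm z * co c i.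
  by rewrite (coordsD symK (hardy z)) (coordsZ symK _ c) coH.
have E0 z : 0 <= hardy_coord e m z i + hardy_norm z * co c i.
  by rewrite addr_ge0 ?(hardy_coord_ge0 symK)// mulr_ge0.
rewrite (E (x + y)) (etrans (coordsD symK _ _ _) (congr2 +%R (E x) (E y))).
rewrite (ger0_norm (E0 _)) (ger0_norm (addr_ge0 (E0 _) (E0 _))).
rewrite [leRHS]addrACA -[X in _ <= _ + X]mulrDl; apply: lerD.
  exact: (hardy_coordD symK).
by rewrite ler_wpM2r//; exact: hardy_norm_seminorm.1.
Qed.

Lemma tail_norm_seminorm k c : (forall i, 0 <= co c i) -> seminorm (tail_norm k c).
Proof.
move=> c0; split=> [x y|t x].
  exact: le_trans (tail_normD k x y c0) ((tail_lattice_seminorm k).1 _ _).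
rewrite /tail_norm hardy_norm_seminorm.2 (hardyZ symK refl_X m_gt1 rho_lt dil).
by rewrite -scalerA -scalerDr (tail_lattice_seminorm k).2 normr_id.
Qed.

Lemma grid_vector_ge0 sd i : 0 <= co (grid_vector sd) i.
Proof.
by rewrite (coords_comb symK) /cut; case: ifP => // _; rewrite divr_ge0.
Qed.

Definition norm_family (t : nat + nat + nat * (seq nat * nat)) : X -> R :=
  match t with
  | inl (inl j) => top_norm e j
  | inl (inr j) => top_l2 j
  | inr (k, sd) => tail_norm k (grid_vector sd)
  end.

Lemma norm_family_hardy_norm : norm_family (inr (0%N, ([::], 0%N))) = hardy_norm.
Proof.
have g0 : grid_vector ([::], 0%N) = 0 by rewrite /grid_vector /comb /= big_geq.
by apply/funext => x; rewrite /norm_family g0 /tail_norm scaler0 addr0 (tail0 e).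
Qed.

Lemma norm_family_tail_norm k x :
  norm_family (inr (k, ([::], 0%N))) x = lat (tail e k (hardy x)).
Proof.
have g0 : grid_vector ([::], 0%N) = 0 by rewrite /grid_vector /comb /= big_geq.
by rewrite /norm_family g0 /tail_norm scaler0 addr0.
Qed.

Lemma norm_family_seminorm t : seminorm (norm_family t).
Proof.
case: t => [[j|j]|[k sd]] /=; first exact: (top_norm_seminorm symK).
  exact: top_l2_seminorm.
by apply: tail_norm_seminorm => i; exact: grid_vector_ge0.
Qed.

Lemma norm_family_bounded t : exists C : R, forall x, norm_family t x <= C * `|x|.
Proof.
case: t => [[j|j]|[k sd]] /=.
- exists (j%:R * coord_bound e K) => x; rewrite -mulrA; exact: top_norm_le.
- have cB0 := ltW (coord_bound_gt0 symK).
  exists (Num.sqrt j%:R * coord_bound e K) => x; rewrite -mulrA.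
  apply: sqr_le_le; first by rewrite !mulr_ge0// sqrtr_ge0.
  rewrite top_l2_sqr exprMn sqr_sqrtr//; apply: top_sum_le_card => //; exact: sq_le.
- have [C C0 NC] := hardy_norm_le; have N0 x := seminorm_ge0 x hardy_norm_seminorm.
  exists (C + C * lat (grid_vector sd)) => x.
  apply: (@le_trans _ _ (lat (hardy x + hardy_norm x *: grid_vector sd))).
    apply: (lattice_norm_mono symK) => i; rewrite (coords_tail symK).
    by case: ifP; rewrite ?normr0.
  apply: (le_trans (slat.1 _ _)); rewrite mulrDl; apply: lerD; first exact: NC.
  rewrite slat.2 ger0_norm// mulrAC ler_wpM2r//.
  exact: (seminorm_ge0 _ slat).
Qed.

Lemma norm_family_bij x y (sigma : nat -> nat) t : bijective sigma ->
  (forall i, `|co y i| = `|co x (sigma i)|) -> norm_family t x = norm_family t y.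
Proof.
move=> bs yx; have hE := hardy_bij symK refl_X m_gt1 rho_lt dil bs yx.
case: t => [[j|j]|[k sd]] /=.
- rewrite /top_norm -(top_sum_bij _ _ bs); congr top_sum.
  by apply/funext => i /=; rewrite yx.
- rewrite /top_l2 -(top_sum_bij _ _ bs); congr (Num.sqrt (top_sum _ _)).
  apply/funext => i /=.
  by rewrite -[LHS]real_normK ?num_real// -yx real_normK ?num_real.
- by rewrite /tail_norm /hardy_norm hE.
Qed.

End family.

(** * Tails of the Hardy transform *)

(** Along the segment from [c + y] to [c + x] the seminorm is convex, with almost equal values at
    the ends and hardly less at the midpoint. The midpoint lies between any other point and the end
    farther from it, so convexity bounds the value at that point from below. *)
Lemma seminorm_segment (R : realType) (V : lmodType R) (q : V -> R) (c x y : V) (eps s : R) :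
  seminorm q -> `|q (c + x) - q (c + y)| <= eps ->
  q (c + x) + q (c + y) - eps <= q (2 *: c + (x + y)) -> 0 <= s <= 1 ->
  q (c + y) - 2 * eps <= q (c + s *: x + (1 - s) *: y).
Proof.
move=> sq; rewrite ler_norml => /andP[h1 h2] mid /andP[s0 s1].
set z := c + s *: x + _.
(* Vectors are coded by their coefficients, so that identities between them reduce to [ring]. *)
pose C (i j k : R) : V := i *: c + j *: x + k *: y.
have CD i j k i' j' k' : C i j k + C i' j' k' = C (i + i') (j + j') (k + k').
  by rewrite /C !scalerDl [LHS]addrACA [X in X + _ = _]addrACA.
have CZ t i j k : t *: C i j k = C (t * i) (t * j) (t * k).
  by rewrite /C !scalerDr !scalerA.
have cxE : c + x = C 1 1 0 by rewrite /C !scale1r scale0r addr0.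
have cyE : c + y = C 1 0 1 by rewrite /C !scale1r scale0r addr0.
have ccE : 2 *: c + (x + y) = C 2 1 1 by rewrite /C !scale1r addrA.
have zE : z = C 1 s (1 - s) by rewrite /C scale1r.
have [s2|s2] := leP s (1 / 2).
  have mE : (1 - s) *: (2 *: c + (x + y)) = z + (1 - 2 * s) *: (c + x).
    by rewrite ccE zE cxE !CZ CD; congr C; ring.
  have := sq.1 z ((1 - 2 * s) *: (c + x)); rewrite -mE !sq.2 !ger0_norm; [|lra..].
  move: (q (c + x)) (q (c + y)) (q z) (q (2 *: c + (x + y))) h1 h2 mid => a b d f h1 h2 mid.
  have : (1 - s) * (a + b - eps) <= (1 - s) * f by rewrite ler_wpM2l//; lra.
  nra.
have mE : s *: (2 *: c + (x + y)) = z + (2 * s - 1) *: (c + y).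
  by rewrite ccE zE cyE !CZ CD; congr C; ring.
have := sq.1 z ((2 * s - 1) *: (c + y)); rewrite -mE !sq.2 !ger0_norm; [|lra..].
move: (q (c + x)) (q (c + y)) (q z) (q (2 *: c + (x + y))) h1 h2 mid => a b d f h1 h2 mid.
have : s * (a + b - eps) <= s * f by rewrite ler_wpM2l//; lra.
nra.
Qed.

Section tails.
Context (R : realType) (X : completeNormedModType R) (e : nat -> X) (K : R).
Hypothesis symK : K_symmetric K e.
Hypothesis refl_X : reflexive_space X.
Context (m : nat) (rho : R).
Hypothesis m_gt1 : (1 < m)%N.
Hypothesis rho_lt : 0 <= rho < m%:R.
Hypothesis dil : forall a n,
  `|comb e (fun j => a (j %/ m)%N) (n * m)| <= rho * `|comb e a n|.
Context (u : nat -> X) (B : R).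
Hypothesis u_le : forall n, `|u n| <= B.
Hypothesis u_const : forall t, exists l, almost_constant (norm_family e m t) u l.
Implicit Types (a b : nat -> R) (x y : X).

Local Notation co := (coords e).
Local Notation hardy := (hardy e m).
Local Notation hardy_norm := (hardy_norm e m).
Local Notation tail_norm := (tail_norm e m).
Local Notation grid_vector := (grid_vector e).
Local Notation lat := (lattice_norm e).

Let K_ge1 : 1 <= K. Proof. by case: symK. Qed.
Let K_ge0 : 0 <= K. Proof. exact: le_trans ler01 K_ge1. Qed.
Let coH := coords_hardy symK refl_X m_gt1 rho_lt dil.
Let slat := lattice_norm_seminorm symK.
Let q k x := lat (tail e k x).
Let sq k : seminorm (q k) := tail_lattice_seminorm symK k.
Let v n := hardy (u n).

Let cone : set X := [set c | forall i, 0 <= co c i].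

Lemma grid_dense c theta : cone c -> 0 < theta -> exists sd, `|c - grid_vector sd| <= theta.
Proof.
move=> c0 th0.
have [n _ /(_ n (leqnn _)) hn] : \forall n \near \oo, `|comb e (co c) n - c| <= theta / 2.
  have := coords_expands symK c; move=> /cvgrPdist_le/(_ _ (divr_gt0 th0 (ltr0n R 2))).
  by apply: filterS => n; rewrite distrC.
pose S := \sum_(0 <= i < n) `|e i|.
have S0 : 0 <= S by exact: sumr_ge0.
(* Rounding the first [n] coordinates down to multiples of [1 / d.+1] moves the vector by at most
   [S / d.+1]. *)
pose d := Num.trunc (S / (theta / 2)).
have dS : S / d.+1%:R <= theta / 2.
  rewrite ler_pdivrMr// mulrC -ler_pdivrMr ?divr_gt0//.
  by apply: ltW; exact: truncnS_gt.
pose s := mkseq (fun i => Num.trunc (co c i * d.+1%:R)) n.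
exists (s, d); rewrite -(subrK (comb e (co c) n) c) -addrA.
apply: (le_trans (ler_normD _ _)); rewrite [leRHS](_ : _ = theta / 2 + theta / 2); last by lra.
apply: lerD; first by rewrite distrC.
rewrite /grid_vector /= size_mkseq /comb -sumrB.
apply: le_trans dS; rewrite mulr_suml; apply: (le_trans (ler_norm_sum _ _ _)).
apply: ler_sum_nat => i /andP[_ i_n]; rewrite -scalerBl normrZ mulrC ler_wpM2l//.
rewrite nth_mkseq// -[X in `|X - _|](@mulfK _ d.+1%:R) ?pnatr_eq0// -mulrBl.
rewrite normrM [X in _ * X]ger0_norm ?invr_ge0// ler_piMl ?invr_ge0//.
have /truncn_itv/andP[t1 t2] : 0 <= co c i * d.+1%:R by rewrite mulr_ge0.
by rewrite ger0_norm ?subr_ge0// lerBlDl natr1 ltW.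
Qed.

Let q_le k x : q k x <= K * K * `|x|.
Proof.
apply: (le_trans (lattice_norm_le symK _)); rewrite -mulrA ler_wpM2l//.
exact: norm_tail.
Qed.

Lemma hardy_norm_almost_constant : exists2 L, 0 <= L & almost_constant hardy_norm u L.
Proof.
have := u_const (inr (0%N, ([::], 0%N))); rewrite norm_family_hardy_norm => -[L hL].
exists L => //.
rewrite leNgt; apply/negP => L0.
have L2 : 0 < - L / 2 by lra.
have [M /(_ M M (leqnn _) (leqnn _))[+ _]] := hL _ L2.
have : 0 <= hardy_norm (u M) by exact: (seminorm_ge0 _ slat).
by rewrite ler_norml; lra.
Qed.

(** Since [hardy_norm (u n)] tends to [L], a grid vector [d] close to [L^-1 *: c] makes
    [hardy_norm (u n) *: d] close to [c]. The almost constant seminorm [tail_norm k d] thus controls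
    the translates by [c] itself. *)
Lemma hardy_spread k c L eps : 0 < L -> almost_constant hardy_norm u L ->
  cone c -> 0 < eps -> exists M, forall i j, (M <= i)%N -> (M <= j)%N ->
    `|q k (c + v i) - q k (c + v j)| <= eps /\
    q k (c + v i) + q k (c + v j) - eps <= q k (2 *: c + (v i + v j)).
Proof.
move=> L0 NL c0 eps0.
(* Eleven errors [eta]: three for each of the two values, one for the grid seminorm at [u i + u j],
   and two for each of the two replacements of a multiple of [d] by [c]. *)
have arith (r1 r2 r3 r4 r5 r6 r7 l : R) : let eta := eps / 11 in
    - (3 * eta) <= r1 - l <= 3 * eta -> - (3 * eta) <= r2 - l <= 3 * eta ->
    r3 - r4 <= r5 -> r5 <= r6 + r7 -> r6 <= 2 * eta -> r7 <= 2 * eta ->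
    2 * l - eta <= r3 -> - eps <= r1 - r2 <= eps /\ r1 + r2 - eps <= r4.
  by move=> /= /andP[? ?] /andP[? ?] *; split; [apply/andP; split|]; lra.
have arith_close (r1 r2 r3 l eta : R) : r1 <= 2 * eta -> - eta <= r3 - l <= eta ->
    r3 - r2 <= r1 -> r2 - r3 <= r1 -> - (3 * eta) <= r2 - l <= 3 * eta.
  by move=> ? /andP[? ?] *; apply/andP; split; lra.
pose eta := eps / 11.
have eta0 : 0 < eta by rewrite divr_gt0.
have K0 : 0 < K * K by rewrite mulr_gt0//; exact: lt_le_trans K_ge1.
have cL0 : cone (L^-1 *: c).
  by move=> i; rewrite (coordsZ symK _ c) mulr_ge0// invr_ge0 ltW.
have [|sd hsd] := @grid_dense _ (eta / (K * K) / L) cL0; first by rewrite !divr_gt0.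
set d := grid_vector sd in hsd.
have d0 : forall i, 0 <= co d i by move=> i; exact: (grid_vector_ge0 symK).
have [l hl] := u_const (inr (k, sd)).
have [M1 hM1] := hl _ eta0.
pose eta' := eta / (K * K) / (1 + `|d|).
have d1 : 0 < 1 + `|d| by rewrite ltr_pwDl.
have eta'0 : 0 < eta' by rewrite !divr_gt0.
have [M2 hM2] := NL _ eta'0.
have near_grid n : (M2 <= n)%N -> q k (c - hardy_norm (u n) *: d) <= 2 * eta.
  move=> Mn; have [Nn _] := hM2 n n Mn Mn.
  apply: (le_trans (q_le _ _)); rewrite -ler_pdivlMl//.
  have -> : c - hardy_norm (u n) *: d = L *: (L^-1 *: c - d) + (L - hardy_norm (u n)) *: d.
    rewrite scalerBr scalerA divff ?gt_eqF// scale1r scalerBl addrA.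
    by rewrite subrK.
  apply: (le_trans (ler_normD _ _)); rewrite !normrZ mulr_natl mulr2n mulrDr.
  apply: lerD.
    rewrite gtr0_norm// mulrC; apply: (le_trans (ler_wpM2r (ltW L0) hsd)).
    by rewrite divfK ?gt_eqF// mulrC.
  rewrite distrC; apply: (le_trans (ler_wpM2r (normr_ge0 d) Nn)).
  rewrite /eta' mulrAC ler_pdivrMr// [X in X * _ <= _]mulrC ler_wpM2l//.
    by rewrite mulr_ge0 ?invr_ge0 ?ltW.
  by rewrite lerDr.
have close n : (M1 <= n)%N -> (M2 <= n)%N -> `|q k (c + v n) - l| <= 3 * eta.
  move=> n1 n2; have [tn _] := hM1 n n n1 n1; have gn := near_grid n n2.
  have E : c - hardy_norm (u n) *: d = (c + v n) - (v n + hardy_norm (u n) *: d).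
    by rewrite opprD addrA addrK.
  have := seminorm_distr (c + v n) (v n + hardy_norm (u n) *: d) (sq k).
  have := seminorm_distr (v n + hardy_norm (u n) *: d) (c + v n) (sq k).
  have E' : (v n + hardy_norm (u n) *: d) - (c + v n) = - (c - hardy_norm (u n) *: d).
    by rewrite E opprB.
  rewrite E' -E (seminormN _ (sq k)).
  by rewrite ler_norml in tn; rewrite ler_norml; exact: arith_close gn tn.
exists (maxn M1 M2) => i j; rewrite !geq_max => /andP[i1 i2] /andP[j1 j2].
have ci := close i i1 i2; have cj := close j j1 j2.
have [_] := hM1 i j i1 j1; rewrite ler_norml => /andP[tij _].
have := tail_normD symK refl_X m_gt1 rho_lt dil k (u i) (u j) d0.
rewrite -/(v i) -/(v j) -/(q k _); set w := (v i + _ + _) => tw.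
have wd := seminorm_distr w (2 *: c + (v i + v j)) (sq k).
have E : w - (2 *: c + (v i + v j)) = - ((c - hardy_norm (u i) *: d) + (c - hardy_norm (u j) *: d)).
  suff gen (x y z p r : X) : (x + p) + (y + r) - (2 *: z + (x + y)) = - ((z - p) + (z - r)).
    exact: gen.
  rewrite [X in X - _]addrACA [2 *: z + _]addrC [X in _ + X = _]opprD [LHS]addrACA subrr add0r.
  by rewrite [in RHS]addrACA -opprD opprB scaler_nat mulr2n.
rewrite E (seminormN _ (sq k)) in wd.
have cd := (sq k).1 (c - hardy_norm (u i) *: d) (c - hardy_norm (u j) *: d).
have gi := near_grid i i2; have gj := near_grid j j2.
have {}tij : 2 * l - eta <= q k w by apply: le_trans tw; rewrite -lerBrDl; exact: tij.
rewrite ler_norml in ci; rewrite ler_norml in cj; rewrite ler_norml.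
exact: arith ci cj wd cd gi gj tij.
Qed.

End tails.

Lemma almost_constant_cvg (R : realType) (X : lmodType R) (p : X -> R) (u : nat -> X) (l : R) :
  almost_constant p u l -> (fun n => p (u n)) @ \oo --> l.
Proof.
move=> h; apply/cvgrPdist_le => eps /h[M hM]; exists M => // n /= Mn.
by rewrite distrC; exact: (hM n n Mn Mn).1.
Qed.

Section tails_small.
Context (R : realType) (X : completeNormedModType R) (e : nat -> X) (K : R).
Hypothesis symK : K_symmetric K e.
Hypothesis refl_X : reflexive_space X.
Context (m : nat) (rho : R).
Hypothesis m_gt1 : (1 < m)%N.
Hypothesis rho_lt : 0 <= rho < m%:R.
Hypothesis dil : forall a n,
  `|comb e (fun j => a (j %/ m)%N) (n * m)| <= rho * `|comb e a n|.
Context (u : nat -> X) (B : R).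
Hypothesis u_le : forall n, `|u n| <= B.
Hypothesis u_const : forall t, exists l, almost_constant (norm_family e m t) u l.
Implicit Types (a b : nat -> R) (x y : X).

Local Notation co := (coords e).
Local Notation hardy := (hardy e m).
Local Notation hardy_norm := (hardy_norm e m).
Local Notation lat := (lattice_norm e).

Let K_ge1 : 1 <= K. Proof. by case: symK. Qed.
Let K_ge0 : 0 <= K. Proof. exact: le_trans ler01 K_ge1. Qed.
Let coH := coords_hardy symK refl_X m_gt1 rho_lt dil.
Let slat := lattice_norm_seminorm symK.

(** The hypothesis [spread] of [convex_selection]: dividing by [mu] reduces it to mass 1, where
    [hardy_spread] provides the almost equal values that [seminorm_segment] asks for. *)
Lemma hardy_spread_segment k L c mu eta : 0 < L -> almost_constant hardy_norm u L ->
  (forall i, 0 <= co c i) -> 0 <= mu -> 0 < eta ->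
  exists M, forall i j s, (M <= i)%N -> (M <= j)%N -> 0 <= s <= 1 ->
    lat (tail e k (c + mu *: hardy (u j))) - eta <=
    lat (tail e k (c + (s * mu) *: hardy (u i) + ((1 - s) * mu) *: hardy (u j))).
Proof.
move=> L0 NL c0; rewrite le_eqVlt => /orP[/eqP <-|mu0] eta0.
  by exists 0%N => i j s _ _ _; rewrite !mulr0 !scale0r !addr0 lerBlDr lerDl ltW.
have sq := tail_lattice_seminorm symK k.
have eps0 : 0 < eta / mu / 2 by rewrite !divr_gt0.
have c'0 i : 0 <= co (mu^-1 *: c) i by rewrite (coordsZ symK _ c) mulr_ge0// invr_ge0 ltW.
have [M hM] := hardy_spread symK refl_X m_gt1 rho_lt dil u_const k L0 NL c'0 eps0.
exists M => i j s Mi Mj s01; have [h1 h2] := hM i j Mi Mj.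
have seg := seminorm_segment sq h1 h2 s01.
have cE : c = mu *: (mu^-1 *: c) by rewrite scalerA divff ?gt_eqF// scale1r.
have E1 : c + mu *: hardy (u j) = mu *: (mu^-1 *: c + hardy (u j)).
  by rewrite scalerDr -cE.
have E2 : c + (s * mu) *: hardy (u i) + ((1 - s) * mu) *: hardy (u j) =
    mu *: (mu^-1 *: c + s *: hardy (u i) + (1 - s) *: hardy (u j)).
  by rewrite 2!scalerDr -cE !scalerA [mu * s]mulrC [mu * (1 - s)]mulrC.
rewrite E1 E2 (tailZ symK k mu (_ + hardy _)) (tailZ symK k mu (_ + _ *: _)) !slat.2 gtr0_norm//.
move: seg.
move: (lat _) (lat _) => b a ab.
have -> : mu * a - eta = mu * (a - 2 * (eta / mu / 2)) by field; rewrite gt_eqF.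
by rewrite ler_wpM2l// ltW.
Qed.

(** This is where the seminorms [top_norm e j] of the family serve: they fix the coordinates of
    every weak limit. *)
Lemma hardy_coord_cvg i : exists alpha : R,
  (fun n => hardy_coord e m (u n) i) @ \oo --> alpha.
Proof.
have [l /almost_constant_cvg lP] := u_const (inl (inl (m ^ trunc_log m i)%N)).
exists (l / (m ^ trunc_log m i)%:R); apply: cvgM; first exact: lP.
exact: cvg_cst.
Qed.

Lemma tail_norm_cvg k : exists T : R, (fun n => lat (tail e k (hardy (u n)))) @ \oo --> T.
Proof.
have [T /almost_constant_cvg TP] := u_const (inr (k, ([::], 0%N))); exists T.
by move: TP; under eq_fun do rewrite norm_family_tail_norm.
Qed.

(* The weak limit produced for the seminorm [lat \o tail k] has coordinates
   [alpha], hence does not depend on [k]. *)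
Lemma weak_limit_tail k L (alpha : nat -> R) T eps : 0 < L -> almost_constant hardy_norm u L ->
  (forall i, (fun n => hardy_coord e m (u n) i) @ \oo --> alpha i) ->
  (fun n => lat (tail e k (hardy (u n)))) @ \oo --> T -> 0 < eps ->
  exists2 x, (forall i, co x i = alpha i) & T - eps <= lat (tail e k x).
Proof.
move=> L0 NL aP TP eps0.
have v_le n : `|hardy (u n)| <= `|hardy_bound K m rho| * B.
  apply: (le_trans (hardy_le symK refl_X m_gt1 rho_lt dil (u n))).
  apply: le_trans (ler_wpM2l (normr_ge0 _) (u_le n)).
  by rewrite ler_wpM2r// ler_norm.
have q_le x : lat (tail e k x) <= K * K * `|x|.
  apply: (le_trans (lattice_norm_le symK _)); rewrite -mulrA ler_wpM2l//.
  exact: norm_tail.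
have sq := tail_lattice_seminorm symK k.
pose cone : set X := [set c | forall i, 0 <= co c i].
have coneD c t n : cone c -> 0 <= t -> cone (c + t *: hardy (u n)).
  move=> c0 t0 i; rewrite (coordsD symK c) (coordsZ symK t) coH.
  by rewrite addr_ge0// mulr_ge0// (hardy_coord_ge0 symK).
have spread c mu eta : cone c -> 0 <= mu -> 0 < eta -> _ :=
  hardy_spread_segment k L0 NL.
have cone0 : cone 0 by move=> i; rewrite (coords0 symK).
have eps2 : 0 < eps / 2 by rewrite divr_gt0.
have Tn : \forall n \near \oo, T - eps / 2 < lat (tail e k (hardy (u n))).
  by apply: (cvgr_gt T TP); rewrite ltrBlDr ltrDl.
have [phi phi_ge low] := convex_selection sq q_le v_le coneD spread cone0 eps2 Tn.
have w_le n : `|hardy (u (phi n))| <= `|hardy_bound K m rho| * B by exact: v_le.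
have [x xT xlim] := reflexive_convex_lower_bound refl_X w_le sq q_le low.
exists x => [i|]; last by rewrite (_ : T - eps = T - eps / 2 - eps / 2)//; field.
apply: (weak_limit_coords symK xlim).
under eq_fun do rewrite coH.
have phi_cvg : phi @ \oo --> \oo.
  move=> A [M _ MA]; exists M => // n /= Mn; apply: MA => /=.
  exact: leq_trans (phi_ge n).
exact: (cvg_comp _ _ phi_cvg (aP i)).
Qed.

Lemma hardy_tail_small eps : 0 < eps ->
  exists k M, forall n, (M <= n)%N -> lat (tail e k (hardy (u n))) <= eps.
Proof.
move=> eps0; have [L L_ge0 NL] := hardy_norm_almost_constant symK u_const.
move: L_ge0; rewrite le_eqVlt => /orP[/eqP L0|L0].
  (* For [L = 0] the whole vectors [hardy (u n)] tend to 0 and no tail has to be cut off. *)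
  have [M hM] := NL _ eps0; exists 0%N, M => n Mn.
  have := (hM n n Mn Mn).1; rewrite -L0 subr0 (tail0 e) => /(le_trans (ler_norm _)).
  by [].
have /choice[alpha aP] := hardy_coord_cvg.
have eps3 : 0 < eps / 3 by rewrite divr_gt0.
(* The tail index 0 only serves to produce the weak limit [x]. Its own tails select [k], for which
   [weak_limit_tail] is then used again. *)
have [T0 T0P] := tail_norm_cvg 0.
have [x xa _] := weak_limit_tail L0 NL aP T0P eps3.
have [k _ /(_ k (leqnn _)) hk] : \forall k \near \oo, K * `|tail e k x| <= eps / 3.
  have tx : (fun k => K * `|tail e k x|) @ \oo --> K * `|0 : X|.
    by apply: cvgM; [exact: cvg_cst|apply: cvg_norm; apply: (tail_cvg symK)].
  by apply: (cvgr_le _ tx); rewrite normr0 mulr0.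
have [T TP] := tail_norm_cvg k.
have [y ya yT] := weak_limit_tail L0 NL aP TP eps3.
have yx : y = x by apply: (coords_inj symK); apply/funext => i; rewrite xa ya.
rewrite yx in yT; have {}hk := le_trans (lattice_norm_le symK _) hk.
have [M _ hM] : \forall n \near \oo, lat (tail e k (hardy (u n))) <= T + eps / 3.
  by apply: (cvgr_le _ TP); rewrite ltrDl.
exists k, M => n /hM /= /le_trans; apply.
have : T - eps / 3 <= eps / 3 := le_trans yT hk.
rewrite lerBlDr -(lerD2r (eps / 3)) => /le_trans; apply.
by rewrite (_ : _ + _ = eps)//; field.
Qed.

End tails_small.

(** * Convergence *)

Section sup_cauchy.
Context (R : realType) (X : completeNormedModType R) (e : nat -> X) (K : R).
Hypothesis symK : K_symmetric K e.
Implicit Types (x y : X) (A : {fset nat}).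

Local Notation co := (coords e).
Local Notation top_l2 := (top_l2 e).

Let l2_on A x : R := Num.sqrt (\sum_(i <- A) co x i ^+ 2).

Let sumsq_ge0 A x : 0 <= \sum_(i <- A) co x i ^+ 2.
Proof. by apply: sumr_ge0 => i _; exact: sqr_ge0. Qed.

Let l2_on_sqr A x : l2_on A x ^+ 2 = \sum_(i <- A) co x i ^+ 2.
Proof. by rewrite sqr_sqrtr. Qed.

Let l2_onD A x y : l2_on A (x + y) <= l2_on A x + l2_on A y.
Proof.
rewrite /l2_on; under eq_bigr => i _ do rewrite (coordsD symK).
exact: l2_triangle.
Qed.

Let top_l2_ge0 j x : 0 <= top_l2 j x. Proof. exact: sqrtr_ge0. Qed.

Let l2_on_le j A x : (#|` A| <= j)%N -> l2_on A x <= top_l2 j x.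
Proof.
by move=> Aj; apply: sqr_le_le => //; rewrite l2_on_sqr; exact: (top_l2_ge symK).
Qed.

Let co_sqr_le x i : co x i ^+ 2 <= (coord_bound e K * `|x|) ^+ 2.
Proof.
rewrite -(real_normK (num_real (co x i))) lerXn2r ?nnegrE//.
  by rewrite mulr_ge0// ltW// (coord_bound_gt0 symK).
exact: (coord_le symK).
Qed.

Let top_l2_near j x eps : 0 < eps ->
  exists2 A, (#|` A| <= j)%N & top_l2 j x - eps <= l2_on A x.
Proof.
move=> eps0; have [h|h] := leP (top_l2 j x) eps.
  exists fset0 => //; apply: (@le_trans _ _ 0); last exact: sqrtr_ge0.
  by rewrite subr_le0.
have [A Aj hA] := top_sum_near (fun i => co x i ^+ 2) j (exprn_gt0 2 eps0).
exists A => //; apply: sqr_le_le; first exact: sqrtr_ge0.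
rewrite l2_on_sqr; apply: le_trans hA; rewrite -(top_l2_sqr symK).
move: h; move: (top_l2 j x) => t h; nra.
Qed.

Let l2_on_diff A x y :
  l2_on A (x - y) ^+ 2 = 2 * l2_on A x ^+ 2 + 2 * l2_on A y ^+ 2 - l2_on A (x + y) ^+ 2.
Proof.
rewrite !l2_on_sqr !mulr_sumr -big_split/= -sumrB; apply: eq_bigr => i _.
by rewrite (coordsD symK x y) (coordsB symK); ring.
Qed.

Let co_le_l2_on A x i : i \in A -> co x i ^+ 2 <= l2_on A x ^+ 2.
Proof.
move=> iA; rewrite l2_on_sqr (big_fsetD1 i)//= lerDl.
by apply: sumr_ge0 => k _; exact: sqr_ge0.
Qed.

Variables (u : nat -> X) (l : nat -> R).
Hypothesis ul : forall j, almost_constant (top_l2 j) u (l j).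

Let l_ge0 j : 0 <= l j.
Proof.
rewrite leNgt; apply/negP => l0; have l2 : 0 < - l j / 2 by lra.
have [M /(_ M M (leqnn _) (leqnn _))[+ _]] := ul j l2.
by have := top_l2_ge0 j (u M); rewrite ler_norml; lra.
Qed.

Let eventually_close j eps : 0 < eps -> exists M, forall m n, (M <= m)%N -> (M <= n)%N ->
  [/\ `|top_l2 j (u n) - l j| <= eps, `|top_l2 j.+1 (u n) - l j.+1| <= eps,
      `|top_l2 j.+2 (u n) - l j.+2| <= eps &
      2 * l j.+1 - eps <= top_l2 j.+1 (u m + u n)].
Proof.
move=> eps0; have [M0 h0] := ul j eps0; have [M1 h1] := ul j.+1 eps0; have [M2 h2] := ul j.+2 eps0.
exists (maxn M0 (maxn M1 M2)) => m n; rewrite !geq_max.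
move=> /andP[m0 /andP[m1 m2]] /andP[n0 /andP[n1 n2]].
split; [exact: (h0 n n n0 n0).1|exact: (h1 n n n1 n1).1|exact: (h2 n n n2 n2).1|].
have := (h1 m n m1 n1).2; rewrite ler_norml => /andP[+ _].
by rewrite lerBrDl.
Qed.

(* A gap between the limits of the [j.+1]-st and [j.+2]-nd largest squares makes
   the set of the [j.+1] largest coordinates of [u n] eventually constant. *)
Let gap_sup_cauchy j kappa : 0 < kappa -> l j.+2 ^+ 2 - l j.+1 ^+ 2 < kappa ->
  kappa <= l j.+1 ^+ 2 - l j ^+ 2 -> exists M, forall m n i, (M <= m)%N -> (M <= n)%N ->
  (co (u m) i - co (u n) i) ^+ 2 <= kappa \/
  co (u m) i ^+ 2 <= 2 * kappa /\ co (u n) i ^+ 2 <= 2 * kappa.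
Proof.
move=> kappa0 small gap.
pose L := 1 + l j + l j.+1 + l j.+2.
have l0 := l_ge0 j; have l1 := l_ge0 j.+1; have l2 := l_ge0 j.+2.
have [L1 jL jL1 jL2] : [/\ 1 <= L, l j + 1 <= L, l j.+1 + 1 <= L & l j.+2 + 1 <= L].
  by rewrite /L; split; lra.
pose gam := Num.min 1 (kappa - (l j.+2 ^+ 2 - l j.+1 ^+ 2)).
have gam0 : 0 < gam by rewrite lt_min ltr01/= subr_gt0.
pose gamk := Num.min gam kappa.
have gk0 : 0 < gamk by rewrite lt_min gam0.
(* In [unique_arith] the two near-maximal sets cost [16 * L * eps] and the errors in the squares
   [8 * L * eps]; the factor 25 keeps the gap strict. *)
pose eps := gamk / (25 * L).
have eps0 : 0 < eps by rewrite divr_gt0// mulr_gt0//; lra.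
have gkE : gamk = 25 * L * eps by rewrite /eps; field; rewrite gt_eqF//; lra.
have gk1 : gamk <= 1 by rewrite /gamk /gam !ge_min lexx.
have gk2 : gamk <= kappa - (l j.+2 ^+ 2 - l j.+1 ^+ 2) by rewrite /gamk /gam !ge_min lexx orbT.
have gk3 : gamk <= kappa by rewrite /gamk !ge_min lexx orbT.
have eps1 : eps <= 1 by nra.
have Leps i : l i <= L -> l i * eps <= L * eps by move=> ?; rewrite ler_wpM2r// ltW.
have le0 : l j * eps <= L * eps by apply: Leps; lra.
have le1 : l j.+1 * eps <= L * eps by apply: Leps; lra.
have le2 : l j.+2 * eps <= L * eps by apply: Leps; lra.
have ee : eps ^+ 2 <= L * eps by nra.
have sq_close (t s : R) : 0 <= t -> 0 <= s -> s + 1 <= L -> `|t - s| <= eps ->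
    `|t ^+ 2 - s ^+ 2| <= 2 * L * eps.
  move=> t0 s0 sL ts; have -> : t ^+ 2 - s ^+ 2 = (t - s) * (t + s) by ring.
  rewrite normrM (ger0_norm (addr_ge0 t0 s0)) mulrC ler_pM ?addr_ge0//.
  by move: ts; rewrite ler_norml => /andP[_ ?]; lra.
have near_arith (t n1 n2 n12 t12 : R) : 0 <= n1 -> n1 <= t -> `|t - l j.+1| <= eps -> n2 <= l j.+1 + eps ->
    n12 <= n1 + n2 -> t12 - eps <= n12 -> 2 * l j.+1 - eps <= t12 -> t ^+ 2 - 8 * L * eps <= n1 ^+ 2.
  move=> n10 n1t; rewrite ler_norml => /andP[? ?] *.
  have d : t - n1 <= 4 * eps by lra.
  have : (t - n1) * (t + n1) <= 4 * eps * (2 * L).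
    by apply: ler_pM; lra.
  by lra.
have unique_arith (t0 t1 t2 : R) : `|t0 - l j ^+ 2| <= 2 * L * eps ->
    `|t1 - l j.+1 ^+ 2| <= 2 * L * eps -> `|t2 - l j.+2 ^+ 2| <= 2 * L * eps ->
    t0 + t2 + 2 * (8 * L * eps) < 2 * t1.
  by rewrite !ler_norml => /andP[? ?] /andP[? ?] /andP[? ?]; nra.
have in_arith (n1 n2 n12 : R) : 0 <= n1 -> 0 <= n2 -> n1 <= l j.+1 + eps -> n2 <= l j.+1 + eps ->
    2 * l j.+1 - 2 * eps <= n12 -> 2 * n1 ^+ 2 + 2 * n2 ^+ 2 - n12 ^+ 2 <= kappa.
  move=> n10 n20 n1l n2l n12l.
  have s1 : n1 ^+ 2 <= (l j.+1 + eps) ^+ 2 by rewrite lerXn2r ?nnegrE//; lra.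
  have s2 : n2 ^+ 2 <= (l j.+1 + eps) ^+ 2 by rewrite lerXn2r ?nnegrE//; lra.
  have s3 : 4 * l j.+1 ^+ 2 - 8 * (l j.+1 * eps) <= n12 ^+ 2.
    have [h|h] := leP eps (l j.+1).
      have : (2 * l j.+1 - 2 * eps) ^+ 2 <= n12 ^+ 2 by rewrite lerXn2r ?nnegrE//; lra.
      by have := sqr_ge0 eps; lra.
    by have := sqr_ge0 n12; nra.
  by nra.
have out_arith (c n1 t1 t2 : R) : c + n1 <= t2 -> t1 - 8 * L * eps <= n1 ->
    `|t1 - l j.+1 ^+ 2| <= 2 * L * eps -> `|t2 - l j.+2 ^+ 2| <= 2 * L * eps -> c <= 2 * kappa.
  by move=> ? ?; rewrite !ler_norml => /andP[? ?] /andP[? ?]; nra.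
have [M hM] := eventually_close j eps0.
(* By the triangle inequality on [A], a set almost maximal for [u m + u n] is almost maximal for
   both summands. *)
have near_max m n A : (M <= m)%N -> (M <= n)%N -> (#|` A| <= j.+1)%N ->
    top_l2 j.+1 (u m + u n) - eps <= l2_on A (u m + u n) ->
    top_l2 j.+1 (u m) ^+ 2 - 8 * L * eps <= l2_on A (u m) ^+ 2 /\
    top_l2 j.+1 (u n) ^+ 2 - 8 * L * eps <= l2_on A (u n) ^+ 2.
  move=> Mm Mn Aj nearA; have [_ cm _ _] := hM n m Mn Mm; have [_ cn _ cmn] := hM m n Mm Mn.
  have um := l2_on_le (u m) Aj; have un := l2_on_le (u n) Aj.
  have ub k : `|top_l2 j.+1 (u k) - l j.+1| <= eps -> l2_on A (u k) <= top_l2 j.+1 (u k) ->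
      l2_on A (u k) <= l j.+1 + eps.
    by rewrite ler_norml => /andP[_ h] h'; apply: (le_trans h'); rewrite -lerBlDl.
  split; [apply: (near_arith _ _ (l2_on A (u n)) (l2_on A (u m + u n)) _ _ um cm _ _ nearA cmn)
    |apply: (near_arith _ _ (l2_on A (u m)) (l2_on A (u m + u n)) _ _ un cn _ _ nearA cmn)];
    rewrite ?sqrtr_ge0 ?ub// ?l2_onD// addrC l2_onD//.
have uniqueA k A1 A2 : (M <= k)%N -> (#|` A1| <= j.+1)%N -> (#|` A2| <= j.+1)%N ->
    top_l2 j.+1 (u k) ^+ 2 - 8 * L * eps <= l2_on A1 (u k) ^+ 2 ->
    top_l2 j.+1 (u k) ^+ 2 - 8 * L * eps <= l2_on A2 (u k) ^+ 2 -> A1 = A2.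
  move=> Mk A1j A2j; rewrite !l2_on_sqr (top_l2_sqr symK) => h1 h2.
  apply: (top_sum_unique (fun i => sqr_ge0 (co (u k) i)) (co_sqr_le (u k)) A1j A2j h1 h2).
  rewrite -!(top_l2_sqr symK); have [c0 c1 c2 _] := hM k k Mk Mk.
  by apply: unique_arith; exact: sq_close.
have /choice[S SP] (p : nat * nat) : exists A, (#|` A| <= j.+1)%N /\
    top_l2 j.+1 (u p.1 + u p.2) - eps <= l2_on A (u p.1 + u p.2).
  by have [D Dj nearD] := top_l2_near j.+1 (u p.1 + u p.2) eps0; exists D.
pose A := S (M, M).
(* [S (m, n)] and [S (m, M)] are both almost maximal for [u m], and [S (m, M)] and [S (M, M)] for
   [u M]; uniqueness identifies all three. *)
have SE m n : (M <= m)%N -> (M <= n)%N -> S (m, n) = A.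
  move=> Mm Mn; have [cmn nmn] := SP (m, n); have [cmM nmM] := SP (m, M).
  have [cMM nMM] := SP (M, M).
  transitivity (S (m, M)).
    apply: (uniqueA m) => //; first by have [] := near_max m n _ Mm Mn cmn nmn.
    by have [] := near_max m M _ Mm (leqnn _) cmM nmM.
  apply: (uniqueA M) => //; first by have [] := near_max m M _ Mm (leqnn _) cmM nmM.
  by have [] := near_max M M _ (leqnn _) (leqnn _) cMM nMM.
exists M => m n i Mm Mn; have [Aj nearA] := SP (m, n); rewrite SE//= in Aj nearA.
have [nm nn] := near_max m n A Mm Mn Aj nearA.
have [_ cm1 cm2 _] := hM n m Mn Mm; have [_ cn1 cn2 cmn] := hM m n Mm Mn.
(* On [A] the parallelogram identity bounds the difference. Off [A], adding [i] gives a sum of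
   [j.+2] squares, whose limit exceeds that for [j.+1] by less than [kappa]. *)
have [iA|iA] := boolP (i \in A); [left|right].
  rewrite -(coordsB symK); apply: (le_trans (co_le_l2_on _ iA)); rewrite l2_on_diff.
  have ub k : `|top_l2 j.+1 (u k) - l j.+1| <= eps -> l2_on A (u k) <= l j.+1 + eps.
    by rewrite ler_norml => /andP[_ h]; apply: (le_trans (l2_on_le (u k) Aj)); rewrite -lerBlDl.
  apply: in_arith; rewrite ?sqrtr_ge0 ?ub//.
  apply: le_trans nearA; apply: le_trans (lerB cmn (lexx _)).
  by rewrite mulr_natl [X in _ - X]mulr_natl mulr2n [eps *+ 2]mulr2n opprD addrA.
have out k : top_l2 j.+1 (u k) ^+ 2 - 8 * L * eps <= l2_on A (u k) ^+ 2 ->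
    `|top_l2 j.+1 (u k) - l j.+1| <= eps -> `|top_l2 j.+2 (u k) - l j.+2| <= eps ->
    co (u k) i ^+ 2 <= 2 * kappa.
  move=> nk c1 c2.
  apply: (out_arith _ (l2_on A (u k) ^+ 2) (top_l2 j.+1 (u k) ^+ 2) (top_l2 j.+2 (u k) ^+ 2)) => //.
  - rewrite l2_on_sqr (top_l2_sqr symK).
    exact: (top_sum_notin (fun i => sqr_ge0 (co (u k) i)) (co_sqr_le (u k)) Aj iA).
  - exact: sq_close.
  - exact: sq_close.
by split; apply: out.
Qed.

(** If all increments of [l j ^+ 2] were at least [kappa], the averages could not become small. At
    the first smaller increment, minimality provides the gap before it; if that is the very first
    increment, all coordinates are already small. *)
Lemma sup_cauchy theta : 0 < theta ->
  (forall delta, 0 < delta -> exists j M, (0 < j)%N /\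
     forall n, (M <= n)%N -> top_l2 j (u n) ^+ 2 <= j%:R * delta) ->
  exists M, forall m n i, (M <= m)%N -> (M <= n)%N -> `|co (u m) i - co (u n) i| <= theta.
Proof.
move=> theta0 avg; pose kappa := (theta / 4) ^+ 2.
have kappa0 : 0 < kappa by rewrite exprn_gt0// divr_gt0.
have small_diff c d : (c - d) ^+ 2 <= kappa \/ c ^+ 2 <= 2 * kappa /\ d ^+ 2 <= 2 * kappa ->
    `|c - d| <= theta.
  have abs_le (t s : R) : 0 <= s -> t ^+ 2 <= s ^+ 2 -> `|t| <= s.
    by move=> s0 ts; apply: sqr_le_le => //; rewrite real_normK ?num_real.
  case=> [h|[hc hd]].
    by apply: abs_le; [exact: ltW|apply: (le_trans h); rewrite /kappa; nra].
  have c2 : `|c| <= theta / 2 by apply: abs_le; [lra|apply: (le_trans hc); rewrite /kappa; nra].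
  have d2 : `|d| <= theta / 2 by apply: abs_le; [lra|apply: (le_trans hd); rewrite /kappa; nra].
  by apply: (le_trans (ler_normB _ _)); apply: (le_trans (lerD c2 d2)); lra.
have l00 : l 0 = 0.
  have := almost_constant_cvg (ul 0); under eq_fun => n.
    rewrite (_ : top_l2 0 (u n) = 0); first over.
    apply/eqP; rewrite -sqrf_eq0 (top_l2_sqr symK) eq_le.
    rewrite (top_sum_ge0 (fun i => sqr_ge0 (co (u n) i)) (co_sqr_le (u n))) andbT.
    have := top_sum_le_card (fun i => sqr_ge0 (co (u n) i)) (co_sqr_le (u n)) 0.
    by rewrite mul0r.
  by move=> h; apply/esym; apply: (cvg_unique _ (cvg_cst 0) h).
have exj : exists j, l j.+1 ^+ 2 - l j ^+ 2 < kappa.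
  apply: contrapT => /forallNP big.
  have grow j : j%:R * kappa <= l j ^+ 2.
    elim: j => [|j ih]; first by rewrite mul0r sqr_ge0.
    have /negP := big j; rewrite -leNgt => hj.
    by rewrite -natr1 mulrDl mul1r; lra.
  have [j [M [j0 hM]]] := avg (kappa / 2) (divr_gt0 kappa0 (ltr0n R 2)).
  have lj : l j ^+ 2 <= j%:R * (kappa / 2).
    have cv := almost_constant_cvg (ul j).
    by apply: (cvgr_to_le (cvgM cv cv)); exists M => // n /= Mn; rewrite -expr2 hM.
  have jk : 0 < j%:R * kappa by rewrite mulr_gt0// ltr0n.
  by have := le_trans (grow j) lj; rewrite mulrA; lra.
have [j jP jmin] := ex_minnP exj.
suff [M hM] : exists M, forall m n i, (M <= m)%N -> (M <= n)%N ->
    (co (u m) i - co (u n) i) ^+ 2 <= kappa \/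
    co (u m) i ^+ 2 <= 2 * kappa /\ co (u n) i ^+ 2 <= 2 * kappa.
  by exists M => m n i Mm Mn; apply: small_diff; exact: hM.
case: j jP jmin => [|j] jP jmin; last first.
  apply: (gap_sup_cauchy kappa0 jP); rewrite leNgt; apply/negP => /jmin.
  by rewrite ltnn.
move: jP; rewrite l00 expr0n/= subr0 => l1.
have cv := almost_constant_cvg (ul 1).
have [M _ hM] : \forall n \near \oo, top_l2 1 (u n) * top_l2 1 (u n) <= 2 * kappa.
  by apply: (cvgr_le _ (cvgM cv cv)); rewrite -expr2; lra.
have co_small n i : (M <= n)%N -> co (u n) i ^+ 2 <= 2 * kappa.
  move=> /hM /= h; apply: le_trans h; rewrite -expr2.
  have := top_l2_ge symK (u n) (_ : (#|` [fset i]%fset| <= 1)%N).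
  by rewrite cardfs1 big_seq_fset1 => /(_ isT).
by exists M => m n i Mm Mn; right; split; exact: co_small.
Qed.

End sup_cauchy.

Section hardy_cauchy.
Context (R : realType) (X : completeNormedModType R) (e : nat -> X) (K : R).
Hypothesis symK : K_symmetric K e.
Hypothesis refl_X : reflexive_space X.
Context (m : nat) (rho : R).
Hypothesis m_gt1 : (1 < m)%N.
Hypothesis rho_lt : 0 <= rho < m%:R.
Hypothesis dil : forall a n,
  `|comb e (fun j => a (j %/ m)%N) (n * m)| <= rho * `|comb e a n|.
Context (u : nat -> X) (B : R).
Hypothesis u_le : forall n, `|u n| <= B.
Hypothesis u_const : forall t, exists l, almost_constant (norm_family e m t) u l.

Local Notation co := (coords e).
Local Notation hardy := (hardy e m).
Local Notation lat := (lattice_norm e).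

Let K_ge1 : 1 <= K. Proof. by case: symK. Qed.
Let K_gt0 : 0 < K. Proof. exact: lt_le_trans K_ge1. Qed.
Let coH := coords_hardy symK refl_X m_gt1 rho_lt dil.

Let top_l2_average (delta : R) : 0 < delta -> exists j M, (0 < j)%N /\
  forall n, (M <= n)%N -> top_l2 e j (u n) ^+ 2 <= j%:R * delta.
Proof.
move=> delta0; pose c := coord_bound e K.
have c0 : 0 < c := coord_bound_gt0 symK.
have B0 : 0 <= B := le_trans (normr_ge0 _) (u_le 0).
have B1 : 0 < B + 1 by rewrite ltr_wpDl.
have cB0 : 0 < c * (c * (B + 1)) := mulr_gt0 c0 (mulr_gt0 c0 B1).
have cB1 : 0 <= c * (B + 1) := ltW (mulr_gt0 c0 B1).
have [k [M hM]] := hardy_tail_small symK refl_X m_gt1 rho_lt dil u_le u_const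
  (divr_gt0 delta0 cB0).
exists (m ^ k)%N, M; split=> [|n Mn]; first by rewrite expn_gt0 ltnW.
have co_le i : `|co (u n) i| <= c * (B + 1).
  apply: (le_trans (coord_le symK _ _)); rewrite ler_wpM2l ?ltW//.
  by apply: (le_lt_trans (u_le n)); rewrite ltrDl.
have mk0 : 0 < (m ^ k)%:R :> R by rewrite ltr0n expn_gt0 ltnW.
have avg : top_norm e (m ^ k) (u n) <= (m ^ k)%:R * (c * (delta / (c * (c * (B + 1))))).
  rewrite mulrC -ler_pdivrMr//.
  have -> : top_norm e (m ^ k) (u n) / (m ^ k)%:R = hardy_coord e m (u n) (m ^ k)%N.
    by rewrite /hardy_coord trunc_expnK.
  have km : (m ^ k < k)%N = false.
    by apply/negbTE; rewrite -leqNgt; exact: ltnW (ltn_expl k m_gt1).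
  have := coord_le symK (tail e k (hardy (u n))) (m ^ k)%N.
  rewrite (coords_tail symK) km coH => /(le_trans (ler_norm _))/le_trans; apply.
  rewrite (ler_wpM2l (ltW c0))//; exact: le_trans (norm_le_lattice symK _) (hM n Mn).
rewrite (top_l2_sqr symK); apply: top_sum_le => A Am.
apply: (@le_trans _ _ (c * (B + 1) * top_norm e (m ^ k) (u n))).
  apply: le_trans (ler_wpM2l _ (top_norm_ge symK (u n) Am)) => //.
  rewrite mulr_sumr; apply: ler_sum => i _.
  by rewrite -(real_normK (num_real (co (u n) i))) expr2 ler_wpM2r.
apply: (le_trans (ler_wpM2l cB1 avg)).
rewrite le_eqVlt; apply/orP; left; apply/eqP; field.
by rewrite !gt_eqF.
Qed.

Lemma hardy_almost_constant_cvg : cvgn u.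
Proof.
apply: cauchy_seq_cvg => eps eps0.
have e1 : 0 < eps / (4 * (K * K)) by rewrite divr_gt0// !mulr_gt0.
have [k [M1 hM1]] := hardy_tail_small symK refl_X m_gt1 rho_lt dil u_le u_const e1.
pose S := \sum_(0 <= i < k) `|e i|.
have S0 : 0 <= S by exact: sumr_ge0.
have S1 : 0 < 1 + S by rewrite ltr_pwDl.
have th0 : 0 < eps / (2 * K * (1 + S)) by rewrite divr_gt0// !mulr_gt0.
have /choice[l ul] j : exists l, almost_constant (top_l2 e j) u l := u_const (inl (inr j)).
have [M2 hM2] := sup_cauchy symK ul th0 top_l2_average.
exists (maxn M1 M2) => n; rewrite geq_max => /andP[n1 n2].
set N := maxn M1 M2; have N1 : (M1 <= N)%N by exact: leq_maxl.
have N2 : (M2 <= N)%N by exact: leq_maxr.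
have co_small i : `|co (u N - u n) i| <= eps / (2 * K * (1 + S)).
  by rewrite (coordsB symK); exact: hM2.
apply: (le_trans (norm_le_hardy_tail symK refl_X m_gt1 rho_lt dil k co_small)).
rewrite -/S.
have tail_le : `|tail e k (hardy (u N - u n))| <= eps / (4 * (K * K)) + eps / (4 * (K * K)).
  apply: (le_trans (norm_le_lattice symK _)).
  apply: le_trans (lerD (hM1 N N1) (hM1 n n1)).
  apply: le_trans ((tail_lattice_seminorm symK k).1 _ _).
  apply: (lattice_norm_mono symK) => i; rewrite !(coords_tail symK).
  case: ifP => _; first by rewrite normr0.
  rewrite (coordsD symK (hardy _) (hardy _)) !coH.
  rewrite !ger0_norm ?addr_ge0 ?(hardy_coord_ge0 symK)//.
  apply: (le_trans (hardy_coordD symK _ _ _ _)).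
  by rewrite -scaleN1r (hardy_coordZ symK) normrN1 mul1r.
move: tail_le; move: `|tail e k _| => t tle.
have h1 : K * (eps / (2 * K * (1 + S)) * S) <= eps / 2.
  have -> : K * (eps / (2 * K * (1 + S)) * S) = eps / 2 * (S / (1 + S)).
    by field; rewrite !gt_eqF.
  by rewrite ler_piMr ?divr_ge0 ?ltW// ltr_pdivrMr// mul1r ltrDr.
have h2 : K * (K * t) <= eps / 2.
  rewrite mulrA mulrC -ler_pdivlMr ?mulr_gt0//; apply: (le_trans tle).
  by rewrite le_eqVlt; apply/orP; left; apply/eqP; field; rewrite gt_eqF.
by rewrite mulrDr; apply: (le_trans (lerD h1 h2)); rewrite -splitr.
Qed.

End hardy_cauchy.

Lemma renormed_cvg (R : realType) (X : normedModType R) (N : norm_on X)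
    (w : nat -> X) (x : X) : equivalent_norm N ->
  (w : nat -> renormed N) @ \oo --> (x : renormed N) <-> w @ \oo --> x.
Proof.
move=> [c [C [c0 C0 cNC]]].
have cN y : `|y| <= c^-1 * N y by rewrite ler_pdivlMl//; have /andP[] := cNC y.
have NC y : N y <= C * `|y| by have /andP[] := cNC y.
split=> /cvgrPdist_le wx; apply/cvgrPdist_le => eps eps0.
  have := wx (c * eps) (mulr_gt0 c0 eps0); apply: filterS => n h.
  by apply: (le_trans (cN _)); rewrite ler_pdivrMl//; exact: h.
have Ceps : 0 < C^-1 * eps by rewrite mulr_gt0 ?invr_gt0.
have := wx (C^-1 * eps) Ceps; apply: filterS => n h.
rewrite renormedE; apply: (le_trans (NC _)).
by rewrite -ler_pdivlMl.
Qed.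

Theorem theorem4p1 (R : realType) (X : completeNormedModType R) (e : nat -> X)
  (refl_X : reflexive_space X) (sym_e : symmetric_basis e)
  (boyd_gt1 : (1 < lower_boyd e)%E) :
  exists N : norm_on X,
    [/\ equivalent_norm N,
        two_rotund (renormed N) &
        K_symmetric 1 (e : nat -> renormed N)].
Proof.
have [K symK] := sym_e; have [K1 basis_e _] := symK.
have [m m1 [rho rho_lt dil]] := dilation_bound symK boyd_gt1.
pose p := norm_family e m.
have ps := norm_family_seminorm symK refl_X m1 rho_lt dil : forall t, seminorm (p t).
have pb := norm_family_bounded symK refl_X m1 rho_lt dil
  : forall t, exists C : R, forall x, p t x <= C * `|x|.
pose N0 := l2_sum pb; have [ND NZ] := l2_sum_seminorm ps pb.
have Nle x : N0 x <= `|x| := l2_sum_le ps pb x.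
have K0 : 0 < K := lt_le_trans ltr01 K1.
have [c c0 leN] : exists2 c : R, 0 < c & forall x, c * `|x| <= N0 x.
  have [c c0 hc] := l2_sum_ge ps pb (inr (0%N, ([::], 0%N))).
  exists (c / (K * K)); first by rewrite divr_gt0// mulr_gt0.
  move=> x; apply: le_trans (hc x); rewrite -mulrA ler_wpM2l ?(ltW c0)//.
  rewrite ler_pdivrMl ?mulr_gt0// /p norm_family_hardy_norm.
  exact: (norm_le_hardy_norm symK refl_X m1 rho_lt dil).
have Neq0 x : N0 x = 0 -> x = 0.
  move=> Nx; apply/eqP; rewrite -normr_le0 -(pmulr_rle0 _ c0) -Nx; exact: leN.
pose N : norm_on X := NormOn ND NZ Neq0.
have eqN : equivalent_norm N by exists c, 1; split=> // x; rewrite mul1r leN Nle.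
exists N; split=> //.
- move=> u u1 u2.
  have u_const : forall t, exists l, almost_constant (p t) (u : nat -> X) l.
    apply: (l2_sum_almost_constant ps (p_bounded := pb)) => // eps eps0.
    have [[A B] [/= [M1 _ AM] [M2 _ BM]] AB] : \forall q \near (\oo, \oo),
        `|2 - `|u q.1 + u q.2| | <= eps by move/cvgrPdist_le : u2; apply.
    exists (maxn M1 M2) => i j; rewrite !geq_max => /andP[i1 i2] /andP[j1 j2].
    have := AB (i, j) (conj (AM i i1) (BM j j2)); rewrite /= => /(le_trans (ler_norm _)).
    by rewrite lerBlDr addrC -lerBlDr.
  have u_le n : `|(u n : X)| <= c^-1.
    rewrite -[leRHS]mulr1 ler_pdivlMl//; apply: (le_trans (leN _)); exact: u1.
  have /cvg_ex[x ux] := hardy_almost_constant_cvg symK refl_X m1 rho_lt dil u_le u_const.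
  by exists x; apply/(renormed_cvg (u : nat -> X) x eqN).
- split=> //.
    move=> x; have [a [ax auniq]] := basis_e x; exists a; split.
      by apply/(renormed_cvg (series (fun n => a n *: e n)) x eqN).
    by move=> b /(renormed_cvg (series (fun n => b n *: e n)) x eqN); exact: auniq.
  move=> a s sigma x bs /(renormed_cvg (series (fun n => a n *: e n)) x eqN) ax.
  have [y ys _] := norm_sign_perm symK s bs ax; exists y.
    exact/(renormed_cvg (series (fun n => ((-1) ^+ s n * a (sigma n)) *: e n)) y eqN).
  rewrite mul1r le_eqVlt; apply/orP; left; apply/eqP.
  apply: esym; apply: l2_sum_eq => t.
  apply: (norm_family_bij symK refl_X m1 rho_lt dil t bs) => i.
  rewrite (expands_coords symK ys) (expands_coords symK ax).
  by rewrite normrM normrX normrN1 expr1n mul1r.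
Qed.
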